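(* Let $(\Omega,\Sigma,\mu)$ be an atomless measure space and consider the Maharam decomposition $$L_1(\mu)\equiv\Big(\bigoplus_{\lambda\in\Lambda}L_1(\{-1,1\}^{\kappa_\lambda})\Big)_{\ell_1}.$$ Then $$\mathfrak{Dau}(L_1(\mu))=\min\{\kappa_\lambda:\lambda\in\Lambda\}.$$
   Context: All Banach spaces are real. $\{-1,1\}^{\kappa}$ carries the product probability measure of the uniform measures on $\{-1,1\}$. The symbol $\equiv$ means isometric isomorphism and $(\bigoplus\cdot)_{\ell_1}$ is the $\ell_1$-sum. Maharam's theorem provides, for every atomless measure $\mu$, a decomposition as displayed, with an index set $\Lambda$ and infinite cardinals $\kappa_\lambda\geq\omega$ for every $\lambda\in\Lambda$. $B_X$ and $S_X$ denote the closed unit ball and unit sphere of a Banach space $X$. A slice of $B_X$ is a nonempty intersection of $B_X$ with an open half-space, i.e. a set $\{x\in B_X: f(x)>\sup f(B_X)-\alpha\}$ with $f\in X^*$, $\alpha>0$. For a cardinal $\kappa$, $\{y_\alpha:\alpha<\kappa\}$ denotes a set of cardinality at most $\kappa$. $X$ has the $\kappa$-Daugavet property if for every family $\{y_\alpha:\alpha<\kappa\}\subseteq S_X$, every slice $S$ of $B_X$ and every $\varepsilon>0$ there is $x\in S$ with $\|y_\alpha+x\|>2-\varepsilon$ for all $\alpha<\kappa$. For nonzero $X$, $\mathfrak{Dau}(X)$ is the least cardinal $\kappa$ such that $X$ fails the $\kappa$-Daugavet property. *)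

(* Defs.v *)
From HB Require Import structures.
From mathcomp Require Import all_boot all_order all_algebra.
From mathcomp Require Import all_classical all_reals all_analysis.
From mathcomp Require Import measurable_realfun.

Set Implicit Arguments.
Unset Strict Implicit.
Unset Printing Implicit Defensive.
Import Order.TTheory GRing.Theory Num.Theory.
Import numFieldNormedType.Exports.

Local Open Scope classical_set_scope.
Local Open Scope card_scope.
Local Open Scope ring_scope.

(* [LspaceType1 mu] is the set of a.e.-classes of integrable functions; it comes
   without algebraic structure or norm, which are added here. *)
Notation L1 mu := (LspaceType1 mu).

Section L1_normedModType.
Context {d : measure_display} {T : measurableType d} {R : realType}.
Variable mu : {measure set T -> \bar R}.
Local Notation Lf := (LfunType mu (@lexx _ _ 1%E)).
Local Notation mR := (measurableTypeR R).

Definition L1_fun (f : L1 mu) : {mfun T >-> mR} :=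
  repr (LebesgueSpace.sort f).

Lemma L1_eqP (f g : L1 mu) : (L1_fun f : T -> R) = L1_fun g %[ae mu] -> f = g.
Proof.
move=> fg.
have fgE : LebesgueSpace.sort f = LebesgueSpace.sort g.
  by rewrite -[LHS]reprK -[RHS]reprK; apply/eqmodP/asboolP; exact: fg.
case: f g fgE {fg} => f [[Pf]] [g [[Pg]]] /= fg; subst g.
congr LebesgueSpace.Pack; congr LebesgueSpace.Class.
by congr isFinLebesgue.Axioms_; exact: Prop_irrelevance.
Qed.

Lemma L1_fun_Lfun (f : L1 mu) : (L1_fun f : T -> R) \in Lfun mu 1%E.
Proof.
rewrite inE; apply/andP; split; rewrite inE/=.
  exact: (@measurable_funPT _ _ _ _ (L1_fun f)).
by case: f => f [[]].
Qed.

Definition L1_rep (f : L1 mu) : Lf := Lfun_Sub (@lexx _ _ 1%E) (L1_fun_Lfun f).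

Definition mfun_of_Lfun (f : Lf) : {mfun T >-> mR} :=
  HB.pack (f : T -> mR)
    (isMeasurableFun.Build _ _ T mR f (@measurable_funPT _ _ _ _ f)).

Definition L1_ae_class (f : Lf) : {mfun_ mu, T >-> mR} :=
  (\pi_{mfun_ mu, T >-> mR} (mfun_of_Lfun f))%qT.

Lemma L1_ae_classE (f : Lf) : (repr (L1_ae_class f) : T -> R) = f %[ae mu].
Proof.
suff /asboolP : ae_eq_op mu (repr (L1_ae_class f)) (mfun_of_Lfun f) by [].
by apply/eqmodP; rewrite reprK.
Qed.

Lemma ae_eq_L1norm (f g : T -> R) :
  measurable_fun setT f -> measurable_fun setT g ->
  f = g %[ae mu] -> ('N[mu]_1[EFin \o f] = 'N[mu]_1[EFin \o g])%E.
Proof.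
move=> mf mg fg; rewrite !Lnorm1; apply: ge0_ae_eq_integral => //.
- by apply: (@measurableT_comp _ _ _ _ _ _ abse) => //; exact/measurable_EFinP.
- by apply: (@measurableT_comp _ _ _ _ _ _ abse) => //; exact/measurable_EFinP.
- by apply: filterS fg => x /= fgx _; rewrite fgx.
Qed.

Lemma L1_ae_class_finite (f : Lf) : finite_norm mu 1%E (L1_ae_class f).
Proof.
rewrite /finite_norm (@ae_eq_L1norm _ f)//; first exact: Lfunction_finite.
  exact: (@measurable_funPT _ _ _ _ (repr (L1_ae_class f))).
exact: L1_ae_classE.
Qed.

Definition L1_class (f : Lf) : L1 mu :=
  HB.pack (L1_ae_class f)
    (isFinLebesgue.Build _ _ _ mu 1%E (@lexx _ _ 1%E) (L1_ae_class f)
       (L1_ae_class_finite f)).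

Lemma L1_classE (f : Lf) : (L1_rep (L1_class f) : T -> R) = f %[ae mu].
Proof. exact: L1_ae_classE. Qed.

Lemma L1_repP (f g : L1 mu) :
  (L1_rep f : T -> R) = L1_rep g %[ae mu] -> f = g.
Proof. exact: L1_eqP. Qed.

HB.instance Definition _ := gen_eqMixin (L1 mu).
HB.instance Definition _ := gen_choiceMixin (L1 mu).

Definition L1_zero : L1 mu := L1_class 0.
Definition L1_opp (f : L1 mu) : L1 mu := L1_class (- L1_rep f).
Definition L1_add (f g : L1 mu) : L1 mu := L1_class (L1_rep f + L1_rep g).
Definition L1_scale (a : R) (f : L1 mu) : L1 mu := L1_class (a *: L1_rep f).
Definition L1_norm (f : L1 mu) : R := fine 'N[mu]_1[EFin \o L1_rep f].

Lemma L1_class_ae (u v : Lf) :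
  (u : T -> R) = v %[ae mu] -> L1_class u = L1_class v.
Proof.
move=> uv; apply: L1_repP.
apply: filterS3 uv (L1_classE u) (L1_classE v) => x /= + + + _.
by move=> -> // -> // -> .
Qed.

Lemma L1_repK (f : L1 mu) : L1_class (L1_rep f) = f.
Proof. exact/L1_repP/L1_classE. Qed.

Lemma L1_classN u : L1_opp (L1_class u) = L1_class (- u).
Proof.
apply: L1_class_ae; apply: filterS (L1_classE u) => x /= + _.
by rewrite /= opprfctE => ->.
Qed.

Lemma L1_classD u v : L1_add (L1_class u) (L1_class v) = L1_class (u + v).
Proof.
apply: L1_class_ae; apply: filterS2 (L1_classE u) (L1_classE v) => x /= + + _.
by rewrite /= !addrfctE => -> // -> .
Qed.

Lemma L1_classZ a u : L1_scale a (L1_class u) = L1_class (a *: u).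
Proof.
apply: L1_class_ae; apply: filterS (L1_classE u) => x /= + _.
by rewrite /= !scalrfctE => ->.
Qed.

Lemma L1_norm_class u : L1_norm (L1_class u) = fine 'N[mu]_1[EFin \o u].
Proof.
congr fine; apply: ae_eq_L1norm; try exact: measurable_funPT.
exact: L1_classE.
Qed.

Lemma L1_addA : associative L1_add.
Proof.
move=> f g h; rewrite -(L1_repK f) -(L1_repK g) -(L1_repK h).
by rewrite !L1_classD addrA.
Qed.

Lemma L1_addC : commutative L1_add.
Proof. by move=> f g; congr L1_class; rewrite addrC. Qed.

Lemma L1_add0 : left_id L1_zero L1_add.
Proof. by move=> f; rewrite -(L1_repK f) L1_classD add0r. Qed.

Lemma L1_addN : left_inverse L1_zero L1_opp L1_add.
Proof. by move=> f; rewrite -(L1_repK f) L1_classN L1_classD addNr. Qed.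

HB.instance Definition _ :=
  GRing.isZmodule.Build (L1 mu) L1_addA L1_addC L1_add0 L1_addN.

Lemma L1_scaleA a b f : L1_scale a (L1_scale b f) = L1_scale (a * b) f.
Proof. by rewrite -(L1_repK f) !L1_classZ scalerA. Qed.

Lemma L1_scale1 : left_id 1 L1_scale.
Proof. by move=> f; rewrite -(L1_repK f) L1_classZ scale1r. Qed.

Lemma L1_scaleDr : right_distributive L1_scale +%R.
Proof.
move=> a f g; rewrite -(L1_repK f) -(L1_repK g).
by rewrite /GRing.add /= !(L1_classD, L1_classZ) scalerDr.
Qed.

Lemma L1_scaleDl f : {morph L1_scale^~ f : a b / a + b}.
Proof.
move=> a b; rewrite -(L1_repK f) /=.
by rewrite /GRing.add /= !(L1_classD, L1_classZ) scalerDl.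
Qed.

HB.instance Definition _ := GRing.Zmodule_isLmodule.Build R (L1 mu)
  L1_scaleA L1_scale1 L1_scaleDr L1_scaleDl.

Lemma L1_ler_normD f g : L1_norm (f + g) <= L1_norm f + L1_norm g.
Proof.
rewrite -(L1_repK f) -(L1_repK g).
by rewrite /GRing.add /= L1_classD !L1_norm_class ler_LnormD.
Qed.

Lemma L1_normrZ a f : L1_norm (a *: f) = `|a| * L1_norm f.
Proof.
rewrite -(L1_repK f) {1}/GRing.scale /= L1_classZ !L1_norm_class.
by apply: EFin_inj; rewrite EFinM !finite_norm_fine LnormZ.
Qed.

Lemma L1_normr0_eq0 f : L1_norm f = 0 -> f = 0.
Proof.
rewrite -(L1_repK f) L1_norm_class => /fine_Lnormr_eq0 f0.
exact: L1_class_ae.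
Qed.

HB.instance Definition _ := Lmodule_isNormed.Build R (L1 mu)
  L1_ler_normD L1_normrZ L1_normr0_eq0.

End L1_normedModType.

Section l1_sum.
Context {R : realType} {I : choiceType}.
Variable X : I -> normedModType R.

Record l1_sum := L1Sum {
  l1_val :> forall i, X i;
  l1_summable : (\esum_(i in [set: I]) `|l1_val i|%:E < +oo)%E }.

HB.instance Definition _ := gen_eqMixin l1_sum.
HB.instance Definition _ := gen_choiceMixin l1_sum.

Lemma l1_sumP (x y : l1_sum) : (forall i, x i = y i) -> x = y.
Proof.
case: x y => [x xs] [y ys] /= xy.
have {}xy : x = y by exact: functional_extensionality_dep.
subst y.
by congr L1Sum; exact: Prop_irrelevance.
Qed.

Definition l1_norm (x : l1_sum) : R :=
  fine (\esum_(i in [set: I]) `|x i|%:E)%E.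

Lemma l1_normE x : (l1_norm x)%:E = (\esum_(i in [set: I]) `|x i|%:E)%E.
Proof.
rewrite fineK// ge0_fin_numE ?l1_summable//.
by apply: esum_ge0 => i _; rewrite lee_fin.
Qed.

Lemma l1_esumD_le (x y : forall i, X i) :
  (\esum_(i in [set: I]) `|(x i + y i)%R|%:E <=
   \esum_(i in [set: I]) `|x i|%:E + \esum_(i in [set: I]) `|y i|%:E)%E.
Proof.
rewrite -esumD; try by move=> i _; rewrite lee_fin.
by apply: le_esum => i _; rewrite -EFinD lee_fin ler_normD.
Qed.

Lemma l1_esumZ (a : R) (x : forall i, X i) :
  (\esum_(i in [set: I]) `|(a *: x i)%R|%:E =
   `|a|%:E * \esum_(i in [set: I]) `|x i|%:E)%E.
Proof.
rewrite (eq_esum (b := fun i => `|a|%:E * `|x i|%:E)%E); last first.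
  by move=> i _; rewrite normrZ EFinM.
rewrite /esum -ereal_supZl//; last first.
  apply/set0P; exists 0%E => /=.
  by exists set0; [exact: fsets_set0|rewrite fsbig_set0].
congr ereal_sup; apply/seteqP; split => [_ [A AI <-]|_ [_ [A AI <-] <-]].
  exists (\sum_(i \in A) `|x i|%:E)%E; first by exists A.
  by rewrite ge0_mule_fsumr// => i; rewrite lee_fin.
by exists A => //; rewrite ge0_mule_fsumr// => i; rewrite lee_fin.
Qed.

Lemma l1_zero_subproof : (\esum_(i in [set: I]) `|0%R : X i|%:E < +oo)%E.
Proof. by rewrite esum1// => i _; rewrite normr0. Qed.

Lemma l1_opp_subproof (x : l1_sum) :
  (\esum_(i in [set: I]) `|(- x i)%R|%:E < +oo)%E.
Proof.
rewrite (eq_esum (b := fun i => `|x i|%:E)); first exact: l1_summable.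
by move=> i _; rewrite normrN.
Qed.

Lemma l1_add_subproof (x y : l1_sum) :
  (\esum_(i in [set: I]) `|(x i + y i)%R|%:E < +oo)%E.
Proof.
by apply: le_lt_trans (l1_esumD_le _ _) _; rewrite lte_add_pinfty// l1_summable.
Qed.

Lemma l1_scale_subproof (a : R) (x : l1_sum) :
  (\esum_(i in [set: I]) `|(a *: x i)%R|%:E < +oo)%E.
Proof. by rewrite l1_esumZ -l1_normE -EFinM ltry. Qed.

Definition l1_zero : l1_sum := L1Sum l1_zero_subproof.
Definition l1_opp (x : l1_sum) : l1_sum := L1Sum (l1_opp_subproof x).
Definition l1_add (x y : l1_sum) : l1_sum := L1Sum (l1_add_subproof x y).
Definition l1_scale (a : R) (x : l1_sum) : l1_sum :=
  L1Sum (l1_scale_subproof a x).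

Lemma l1_addA : associative l1_add.
Proof. by move=> x y z; apply: l1_sumP => i /=; rewrite addrA. Qed.

Lemma l1_addC : commutative l1_add.
Proof. by move=> x y; apply: l1_sumP => i /=; rewrite addrC. Qed.

Lemma l1_add0 : left_id l1_zero l1_add.
Proof. by move=> x; apply: l1_sumP => i /=; rewrite add0r. Qed.

Lemma l1_addN : left_inverse l1_zero l1_opp l1_add.
Proof. by move=> x; apply: l1_sumP => i /=; rewrite addNr. Qed.

HB.instance Definition _ :=
  GRing.isZmodule.Build l1_sum l1_addA l1_addC l1_add0 l1_addN.

Lemma l1_scaleA a b x : l1_scale a (l1_scale b x) = l1_scale (a * b) x.
Proof. by apply: l1_sumP => i /=; rewrite scalerA. Qed.

Lemma l1_scale1 : left_id 1 l1_scale.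
Proof. by move=> x; apply: l1_sumP => i /=; rewrite scale1r. Qed.

Lemma l1_scaleDr : right_distributive l1_scale +%R.
Proof. by move=> a x y; apply: l1_sumP => i /=; rewrite scalerDr. Qed.

Lemma l1_scaleDl x : {morph l1_scale^~ x : a b / a + b}.
Proof. by move=> a b; apply: l1_sumP => i /=; rewrite scalerDl. Qed.

HB.instance Definition _ := GRing.Zmodule_isLmodule.Build R l1_sum
  l1_scaleA l1_scale1 l1_scaleDr l1_scaleDl.

Lemma l1_ler_normD x y : l1_norm (x + y) <= l1_norm x + l1_norm y.
Proof. by rewrite -lee_fin EFinD !l1_normE; exact: l1_esumD_le. Qed.

Lemma l1_normrZ a x : l1_norm (a *: x) = `|a| * l1_norm x.
Proof. by apply: EFin_inj; rewrite EFinM !l1_normE; exact: l1_esumZ. Qed.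

Lemma l1_normr0_eq0 x : l1_norm x = 0 -> x = 0.
Proof.
move=> x0; apply: l1_sumP => i; apply/eqP; rewrite -normr_le0 -lee_fin.
rewrite -[leRHS]/(0%:E) -x0 l1_normE.
rewrite -(@esum_set1 _ _ i (fun i => `|x i|%:E)%E) ?lee_fin//.
by apply: ereal_sup_le => _ [A [finA AS] <-]; exists A.
Qed.

HB.instance Definition _ := Lmodule_isNormed.Build R l1_sum
  l1_ler_normD l1_normrZ l1_normr0_eq0.

End l1_sum.

(* The cube {-1,1}^K, with [true] for 1 and [false] for -1, equipped with the
   product sigma-algebra. *)
Definition sign_cube (K : Type) : Type :=
  g_sigma_algebraType
    [set A : set (K -> bool) |
      exists k (B : set bool), A = [set x | B (x k)]].

HB.instance Definition _ (K : Type) := Measurable.on (sign_cube K).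

Section sign_cube_product.
Context {R : realType} {K : Type}.

(* [P] is the product measure: a measurable rectangle restricting finitely many
   coordinates has the product of the masses of its sides, the uniform
   probability on {-1,1} being [bernoulli_prob 2^-1]. This determines [P]. *)
Definition product_of_uniform (P : probability (sign_cube K) R) : Prop :=
  forall (n : nat) (k : 'I_n -> K) (B : 'I_n -> set bool), injective k ->
    P [set x | forall j, B j ((x : K -> bool) (k j))] =
    (\prod_(j < n) bernoulli_prob (2^-1 : R) (B j))%E.

End sign_cube_product.

(* A non-null measurable set is an atom when it does not split into two
   measurable non-null pieces. *)
Definition atom {d} {T : measurableType d} {R : realType}
    (mu : {measure set T -> \bar R}) (A : set T) : Prop :=
  [/\ measurable A, (0 < mu A)%E &
      forall B, measurable B -> B `<=` A -> mu B = 0%E \/ mu (A `\` B) = 0%E].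

Definition atomless {d} {T : measurableType d} {R : realType}
    (mu : {measure set T -> \bar R}) : Prop :=
  forall A, ~ atom mu A.

Definition isometrically_isomorphic {R : realType} (X Y : normedModType R) :
    Prop :=
  exists T : {linear X -> Y}, bijective T /\ forall x, `|T x| = `|x|.

Section Daugavet.
Context {R : realType} (X : normedModType R).

Definition unit_ball : set X := [set x | `|x| <= 1].

Definition unit_sphere : set X := [set x | `|x| = 1].

Definition slice (f : X -> R) (alpha : R) : set X :=
  [set x | unit_ball x /\ f x > sup (f @` unit_ball) - alpha].

(* Cardinals are represented by types up to equipotence; a family
   {y_k : k < K} in the unit sphere is a subset of cardinality at most K. *)
Definition Daugavet_property (K : Type) : Prop :=
  forall (Y : set X) (f : {linear X -> R^o}) (alpha eps : R),
    Y `<=` unit_sphere -> Y #<= [set: K] ->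
    continuous f -> 0 < alpha -> 0 < eps ->
    exists2 x, slice f alpha x & forall y, Y y -> `|y + x| > 2 - eps.

(* [is_Dau K] : the cardinal of [K] is Dau(X); meaningful for nonzero [X]. *)
Definition is_Dau (K : Type) : Prop :=
  ~ Daugavet_property K /\
  forall K' : Type, ~ Daugavet_property K' -> [set: K] #<= [set: K'].

End Daugavet.

Definition is_min_cardinal {I : Type} (kappa : I -> Type) (K : Type) : Prop :=
  (exists i, [set: K] #= [set: kappa i]) /\
  forall i, [set: K] #<= [set: kappa i].

(* Main.v *)
(* Functions depending on finitely many coordinates are dense in
   L_1({-1,1}^kappa), hence so are those coming from a family of kappa many
   rational tables.

   Upper bound: fix an index l. On the slice where the integral of the l-th
   coordinate exceeds 3/4, a point x of the ball is carried by that coordinate up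
   to 1/4, and some normalized table y, of which there are kappa_l many, is close
   to -x; then |x + y| stays away from 2.

   Lower bound: let K be a cardinal with no kappa_l <= K, Y a set of at most K
   unit vectors and f a functional. The slice contains a normalized h depending on
   finitely many coordinates of a single summand L_1({-1,1}^kappa_l), and up to a
   small error each y in Y has an l-th coordinate depending on a finite set of
   coordinates. These sets leave a coordinate of kappa_l free, and multiplying h by
   twice the indicator of a half cube along it keeps the norm of h, does not
   decrease f (for one of the two halves) and halves the part of y living on the
   support of h. After n steps h is almost disjoint from every y in Y, so that
   |y + h| is almost 2.

   The cardinal arithmetic needed is the existence of a least cardinal in a
   family and the idempotence kappa * kappa = kappa. *)

Require Import Defs.
From HB Require Import structures.
From mathcomp Require Import all_boot all_order all_algebra.
From mathcomp Require Import all_classical all_reals all_analysis.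
From mathcomp Require Import measurable_realfun.
From mathcomp Require Import ring lra.

Set Implicit Arguments.
Unset Strict Implicit.
Unset Printing Implicit Defensive.
Import Order.TTheory GRing.Theory Num.Theory.
Import numFieldNormedType.Exports.

Local Open Scope classical_set_scope.
Local Open Scope ring_scope.

(** * Cardinals *)

(** Injections between whole types compose and multiply directly, which keeps the cardinal
    arithmetic free of the set-based [#<=]. *)
Definition embeds (A B : Type) : Prop := exists f : A -> B, injective f.

Lemma embedsP (A B : Type) : ([set: A] #<= [set: B])%card <-> embeds A B.
Proof.
split=> [/card_leP[f]|[f finj]].
  exists (fun x => val (f (SigSub (mem_set (I : [set: A] x))))) => x y /val_inj.
  by move=> /(@inj _ _ _ f _ _ (mem_set I) (mem_set I))/(congr1 val).
rewrite -(card_le_eql (inj_card_eq (f := f) (A := setT) _)).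
  exact: card_leT.
by move=> x y _ _; exact: finj.
Qed.

Lemma embeds_trans (A B C : Type) : embeds A B -> embeds B C -> embeds A C.
Proof. by move=> [f fI] [g gI]; exists (g \o f); exact: inj_comp. Qed.

Lemma embeds_pair (A B C D : Type) :
  embeds A B -> embeds C D -> embeds (A * C) (B * D).
Proof.
move=> [f fI] [g gI]; exists (fun p => (f p.1, g p.2)).
by move=> [a c] [a' c'] [/fI -> /gI ->].
Qed.

Lemma sig_inj (T : Type) (P : T -> Prop) : injective (@proj1_sig T P).
Proof. by move=> [x Px] [y Py] /= xy; subst y; rewrite (Prop_irrelevance Px Py). Qed.

(* A maximal set of choice functions on which all projections are injective has
   a surjective projection; that factor embeds into every other one. *)
Lemma min_embeds (I : Type) (k : I -> Type) (i0 : I) :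
  exists i, forall j, embeds (k i) (k j).
Proof.
pose Q (B : set (forall i, k i)) :=
  forall f g, B f -> B g -> forall i, f i = g i -> f = g.
have [|B [QB maxB]] := @Zorn_bigcup _ Q.
  move=> F FQ Ftot f g [X FX Xf] [Y FY Yg].
  have [XY|YX] := Ftot _ _ FX FY.
    exact: FQ _ FY _ _ (XY _ Xf) Yg.
  exact: FQ _ FX _ _ Xf (YX _ Yg).
have [i surj_i] : exists i, forall a, exists2 f, B f & f i = a.
  apply: contrapT => /forallNP noti.
  have nsurj i : {a | forall f, B f -> f i <> a}.
    apply: cid; have /existsNP[a aP] := noti i; exists a => f Bf fa.
    by apply: aP; exists f.
  pose h i := sval (nsurj i).
  have hP i : forall f, B f -> f i <> h i := svalP (nsurj i).
  apply: (maxB (B `|` [set h])).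
    split; first by move=> f; left.
    by move=> /(_ h (or_intror erefl)) /(hP i0)/(_ erefl).
  move=> f g [Bf|->] [Bg|->] i //; first exact: QB.
    by move=> /(hP i _ Bf).
  by move=> /esym /(hP i _ Bg).
have /choice[s sP] : forall a, exists f, B f /\ f i = a.
  by move=> a; have [f] := surj_i a; exists f.
exists i => j; exists (fun a => s a j) => a b sab.
by rewrite -(sP a).2 -(sP b).2 (QB _ _ (sP a).1 (sP b).1 _ sab).
Qed.

(** Comparability of cardinals is the existence of a least member in a two-element family. *)
Lemma embeds_total (A B : Type) : embeds A B \/ embeds B A.
Proof.
by have [[] iP] := min_embeds (fun b : bool => if b then A else B) true;
  [left; exact: (iP false)|right; exact: (iP true)].
Qed.

Lemma infinite_embeds (K : Type) : infinite_set [set: K] -> embeds nat K.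
Proof. by move=> /infiniteP/embedsP. Qed.

(* Zorn's lemma on graphs of injections A * A -> A with A a subset of K: if A is
   not yet equipotent to K, its complement contains a copy B of A, into which
   the new pairs of (A \cup B) * (A \cup B) can be mapped. *)
Section square.
Variable K : Type.
Hypothesis Kinf : infinite_set [set: K].

Let base (G : set ((K * K) * K)) : set K := [set a | exists z, G ((a, a), z)].

(** The domain is the square of [base G], read off the diagonal. An infinite base is demanded only
    of nonempty graphs, because the union of the empty chain must be a graph too. *)
Let graph (G : set ((K * K) * K)) : Prop :=
  [/\ forall p z z', G (p, z) -> G (p, z') -> z = z',
      forall p p' z, G (p, z) -> G (p', z) -> p = p',
      forall a b z, G ((a, b), z) -> [/\ base G a, base G b & base G z],
      forall a b, base G a -> base G b -> exists z, G ((a, b), z) &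
      G !=set0 -> exists2 e : nat -> K, injective e & forall n, base G (e n)].

Let graph_bigcup (F : set (set ((K * K) * K))) :
  F `<=` graph -> total_on F subset -> graph (\bigcup_(G in F) G).
Proof.
move=> FG Ftot.
have baseU G : F G -> base G `<=` base (\bigcup_(G in F) G).
  by move=> FGG a [z zP]; exists z, G.
have common p q : (\bigcup_(G in F) G) p -> (\bigcup_(G in F) G) q ->
    exists2 G, F G & G p /\ G q.
  move=> [G FGG Gp] [H FH Hq]; have [GH|HG] := Ftot _ _ FGG FH.
    by exists H => //; split=> //; exact: GH.
  by exists G => //; split=> //; exact: HG.
split.
- move=> p z z' /common/[apply] -[G FGG [Gp Gq]].
  by have [G1 _ _ _ _] := FG _ FGG; exact: G1 Gp Gq.
- move=> p p' z /common/[apply] -[G FGG [Gp Gq]].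
  by have [_ G2 _ _ _] := FG _ FGG; exact: G2 Gp Gq.
- move=> a b z [G FGG Gabz]; have [_ _ + _ _] := FG _ FGG.
  by move=> /(_ _ _ _ Gabz)[? ? ?]; split; apply: baseU FGG _ _.
- move=> a b [z za] [z' zb]; have [G FGG [Ga Gb]] := common _ _ za zb.
  have [_ _ _ + _] := FG _ FGG.
  move=> /(_ a b)[||y Gy]; [by exists z|by exists z'|].
  by exists y, G.
- move=> [p [G FGG Gp]]; have [_ _ _ _ +] := FG _ FGG.
  by case; [exists p|move=> e eI eP; exists e => // n; exact: baseU (eP n)].
Qed.

(** The pairing of [nat], carried to a copy of [nat] inside [K], rules out the empty set as a
    maximal graph. *)
Let graph_nat : exists2 G, graph G & G !=set0.
Proof.
have [e eI] := infinite_embeds Kinf.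
pose G : set ((K * K) * K) :=
  [set p | exists i j, p = ((e i, e j), e (pickle (i, j)))].
have baseG a : base G a <-> exists n, a = e n.
  split=> [[z [i [j [-> _ _]]]]|[n ->]]; first by exists i.
  by exists (e (pickle (n, n))), n, n.
exists G; last by exists ((e 0, e 0), e (pickle (0, 0)))%N, 0%N, 0%N.
split.
- by move=> p z z' [i [j [-> ->]]] [i' [j' [/eI -> /eI -> ->]]].
- move=> p p' z [i [j [-> ->]]] [i' [j' [-> /eI]]].
  by move=> /(pcan_inj pickleK)[-> ->].
- by move=> a b z [i [j [-> -> ->]]]; split; apply/baseG; eexists.
- by move=> a b /baseG[i ->] /baseG[j ->]; eexists; exists i, j.
- by move=> _; exists e => // n; apply/baseG; exists n.
Qed.

Lemma embeds_square : embeds (K * K) K.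
Proof.
have [G [[G1 G2 G3 G4 G5] maxG]] := Zorn_bigcup graph_bigcup.
have gG : graph G by split.
have Gn0 : G !=set0.
  apply/set0P/negP => /eqP G0; have [H gH [x Hx]] := graph_nat.
  apply: (maxG H) => //; rewrite G0; split => // /(_ x Hx) //.
pose A := base G.
have [e eI eP] := G5 Gn0.
pose sA := {a : K | A a}; pose sC := {a : K | ~ A a}.
have AA : embeds (sA * sA) sA.
  have /choice[m mP] : forall p : sA * sA, exists z : sA,
      G ((sval p.1, sval p.2), sval z).
    move=> [[a Aa] [b Ab]] /=; have [z Gz] := G4 _ _ Aa Ab.
    by have [_ _ Az] := G3 _ _ _ Gz; exists (exist _ z Az).
  exists m => -[a b] [c d] mab; have := mP (a, b); rewrite mab.
  by move=> /G2 /(_ (mP (c, d)))[/sig_inj -> /sig_inj ->].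
have boolA : embeds bool sA.
  exists (fun b : bool => exist _ (e b) (eP b)).
  by move=> b c [/eI]; case: b c => [] [].
have bA : embeds (bool * sA) sA.
  by apply: embeds_trans AA; apply: embeds_pair => //; exists id.
(* If the complement of A is no larger than A, then [K] is at most twice A, hence at most A * A,
   hence at most A. *)
have KC : embeds sC sA -> embeds K sA.
  move=> [u uI]; apply: embeds_trans bA.
  exists (fun x => match pselect (A x) with
    | left Ax => (true, exist _ x Ax) | right Ax => (false, u (exist _ x Ax)) end).
  move=> x y; case: pselect => Ax; case: pselect => Ay // [] //.
  by move=> /uI[].
have [|/KC KA] := embeds_total sA sC; last first.
  apply: embeds_trans (embeds_trans (embeds_pair KA KA) AA) _.
  by exists sval; exact: sig_inj.
move=> [u uI]; exfalso.
have [w wI] : embeds ((bool * sA) * (bool * sA)) sA.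
  exact: embeds_trans (embeds_pair bA bA) AA.
(* The tag [false] parametrizes A itself, the tag [true] its copy in the complement. *)
pose rho (s : bool * sA) : K := if s.1 then sval (u s.2) else sval s.2.
have rhoA s : A (rho s) <-> ~~ s.1.
  by case: s => -[] a; rewrite /rho /=; split => //; [move/(svalP (u a))|
    move=> _; exact: svalP].
have rhoI : injective rho.
  move=> s t st; have := rhoA s; rewrite st rhoA.
  case: s t st => -[] a [[] b] //=; rewrite /rho /=.
  - by move=> ab _; rewrite (uI _ _ (sig_inj ab)).
  - by move=> _ [/(_ isT)].
  - by move=> _ [_ /(_ isT)].
  - by move=> ab _; rewrite (sig_inj ab).
(* A pair with at least one [true] tag takes its value in the copy of A, away from all values
   already used by [G]. *)
pose H := G `|` [set q | exists s t, [/\ s.1 || t.1 &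
   q = ((rho s, rho t), sval (u (w (s, t))))]].
have baseH a : base H a <-> exists s, a = rho s.
  split=> [[z [Gz|[s [t [_ [-> _ _]]]]]]|[[[] b] ->]].
  - have Aa : A a by exists z.
    by exists (false, exist _ a Aa).
  - by exists s.
  - by eexists; right; exists (true, b), (true, b); split.
  - by have [z Gz] := svalP b; exists z; left.
have Gnew s t z : s.1 || t.1 -> ~ G ((rho s, rho t), z).
  move=> st /G3[/rhoA + /rhoA + _].
  by case/orP: st => ->.
apply: (maxG H).
  split; first by move=> x; left.
  (* The extension is strict: a pair of points tagged [true] lies in [H] but not in [G]. *)
  have a : sA := exist _ (e 0%N) (eP 0%N).
  move=> /(_ ((rho (true, a), rho (true, a)), sval (u (w ((true, a), (true, a)))))) HG.
  apply: (@Gnew (true, a) (true, a)); last apply: HG; first by [].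
  by right; exists (true, a), (true, a); split.
split.
- move=> p z z' [Gz|[s [t [st [-> ->]]]]] [Gz'|[s' [t' [st' E]]]].
  + exact: G1 Gz Gz'.
  + by case: E Gz => -> _ /(Gnew _ _ _ st').
  + by case: (Gnew _ _ _ st Gz').
  + by case: E => /rhoI -> /rhoI -> ->.
- move=> p p' z [Gz|[s [t [st [-> ->]]]]] [Gz'|[s' [t' [st' E]]]].
  + exact: G2 Gz Gz'.
  + case: p Gz => a b /G3[_ _]; case: E => _ ->.
    by move/(svalP (u (w (s', t')))).
  + by case: p' Gz' => a b /G3[_ _] /(svalP (u (w (s, t)))).
  + by case: E => -> /sig_inj/uI/wI[-> ->].
- move=> a b z [/G3[Aa Ab Az]|[s [t [_ [-> -> ->]]]]].
    split; apply/baseH.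
    + by exists (false, exist _ a Aa).
    + by exists (false, exist _ b Ab).
    + by exists (false, exist _ z Az).
  split; apply/baseH; [by exists s|by exists t|].
  by exists (true, w (s, t)).
- move=> a b /baseH[s ->] /baseH[t ->].
  have [st|] := boolP (s.1 || t.1).
    by eexists; right; exists s, t; split.
  rewrite negb_or => /andP[/rhoA As /rhoA At].
  by have [z Gz] := G4 _ _ As At; exists z; left.
- move=> _; exists e => // n; apply/baseH.
  by exists (false, exist _ (e n) (eP n)).
Qed.
End square.

(** A list is folded into one point by the pairing. Its length is recorded as well, since the code
    [e 0] of the empty list might also be the value of a pair. *)
Lemma embeds_seq (A K : Type) :
  infinite_set [set: K] -> embeds A K -> embeds (seq A) K.
Proof.
move=> Kinf [u uI]; have [p pI] := embeds_square Kinf.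
have [e eI] := infinite_embeds Kinf.
pose enc := foldr (fun a k => p (u a, k)) (e 0%N).
exists (fun s => p (e (size s), enc s)) => s t /pI[/eI].
elim: s t => [|a s IH] [|b t] //= [/IH st] /pI[/uI -> /st ->] //.
Qed.

Lemma embeds_countType (C : countType) (K : Type) :
  infinite_set [set: K] -> embeds C K.
Proof.
move=> /infinite_embeds[e eI]; exists (e \o pickle).
exact: inj_comp eI (pcan_inj pickleK).
Qed.

Lemma embeds_prod (A B K : Type) : infinite_set [set: K] ->
  embeds A K -> embeds B K -> embeds (A * B) K.
Proof.
move=> Kinf AK BK.
exact: embeds_trans (embeds_pair AK BK) (embeds_square Kinf).
Qed.

(* For finite [Y] this only uses that [K] is infinite, otherwise that
   #|Y| * aleph_0 = #|Y|. *)
Lemma fresh_coordinate (K : choiceType) (T : Type) (Y : set T)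
    (F : T -> seq K) (e : seq K) :
  infinite_set [set: K] -> ~ ([set: K] #<= Y)%card ->
  exists k, k \notin e /\ forall y, Y y -> k \notin F y.
Proof.
move=> Kinf KY; apply: contrapT => /forallNP nofresh.
have cover k : k \notin e -> exists2 y, Y y & k \in F y.
  move=> ke; apply: contrapT => /forall2NP nF; apply: (nofresh k); split => //.
  by move=> y Yy; apply/negP => kF; case: (nF y).
(* For finite [Y], the lists without a fresh coordinate would cover [K] by finitely many points. *)
have [fY|iY] := pselect (finite_set Y).
  apply: Kinf; apply: (@sub_finite_set _ _ ([set` e] `|` \bigcup_(y in Y) [set` F y])).
    move=> k _; have [ke|/cover[y Yy ky]] := boolP (k \in e); first by left.
    by right; exists y.
  rewrite finite_setU; split; first exact: finite_seq.
  by apply: bigcup_finite => // y _; exact: finite_seq.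
have VY : ([set: Y] #<= Y)%card by rewrite (card_le_eql (card_setT Y)) card_lexx.
have YV : (Y #<= [set: Y])%card by rewrite (card_le_eqr (card_setT Y)) card_lexx.
have iV : infinite_set [set: Y] by move=> /(card_le_finite YV).
apply: KY; apply: card_le_trans VY; apply/embedsP.
suff : embeds K (bool * (Y * nat)).
  move/embeds_trans; apply; apply: embeds_prod => //.
    exact: embeds_countType.
  by apply: embeds_prod => //; [exists id|exact: embeds_countType].
have [v0 _] := infinite_setN0 iV.
have /choice[g gP] : forall k, exists q : bool * (Y * nat),
    k = nth k (if q.1 then e else F (val q.2.1)) q.2.2 /\
    (q.2.2 < size (if q.1 then e else F (val q.2.1)))%N.
  move=> k; have [ke|/cover[y Yy kFy]] := boolP (k \in e).
    by exists (true, (v0, index k e)); rewrite /= nth_index// index_mem.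
  exists (false, (SigSub (mem_set Yy), index k (F y))).
  by rewrite /= nth_index// index_mem.
exists g => k k' kk'; rewrite (gP k).1 [RHS](gP k').1 kk'.
(* The two [nth] differ only in their default, which is irrelevant as the position is in range. *)
by apply: set_nth_default; exact: (gP k').2.
Qed.

(** * Classes of integrable functions *)

Section L1_of.
Context {d : measure_display} {T : measurableType d} {R : realType}.
Variable mu : {measure set T -> \bar R}.
Implicit Types g h : T -> R.

(* The zero class when [g] is not integrable. *)
Definition L1_of g : L1 mu := L1_class (insubd (0 : LfunType mu (@lexx _ _ 1%E)) g).

Lemma insubd_Lfun g : g \in Lfun mu 1%E ->
  (insubd (0 : LfunType mu (@lexx _ _ 1%E)) g : T -> R) = g.
Proof. exact: insubdK. Qed.

Lemma L1_norm_of g : g \in Lfun mu 1%E -> `|L1_of g| = \int[mu]_x `|g x|.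
Proof.
by move=> gL; rewrite [LHS]L1_norm_class Lnorm1 insubd_Lfun.
Qed.

Lemma L1_ofD g h : g \in Lfun mu 1%E -> h \in Lfun mu 1%E ->
  L1_of (g + h) = L1_of g + L1_of h.
Proof.
move=> gL hL; rewrite [RHS]L1_classD; congr L1_class; apply: val_inj.
by rewrite /= insubdK ?rpredD// !insubd_Lfun.
Qed.

Lemma L1_ofZ a g : g \in Lfun mu 1%E -> L1_of (a *: g) = a *: L1_of g.
Proof.
move=> gL; rewrite [RHS]L1_classZ; congr L1_class; apply: val_inj.
by rewrite /= insubdK ?rpredZ// !insubd_Lfun.
Qed.

Lemma L1_of_rep (f : L1 mu) : L1_of (L1_rep f) = f.
Proof.
rewrite -[RHS]L1_repK; congr L1_class; apply: val_inj; rewrite /= insubd_Lfun //.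
exact: L1_fun_Lfun.
Qed.

Lemma L1_ofB g h : g \in Lfun mu 1%E -> h \in Lfun mu 1%E ->
  L1_of (g - h) = L1_of g - L1_of h.
Proof.
by move=> gL hL; rewrite L1_ofD ?rpredN// -scaleN1r L1_ofZ// scaleN1r.
Qed.

Definition L1_integral (f : L1 mu) : R^o := \int[mu]_x L1_rep f x.

Lemma L1_integral_of g : g \in Lfun mu 1%E ->
  L1_integral (L1_of g) = \int[mu]_x g x.
Proof.
move=> gL; rewrite /L1_integral /Rintegral; congr fine.
apply: ae_eq_integral => //.
- by case/Lfun1_integrable/integrableP: (L1_fun_Lfun (L1_of g)).
- by case/Lfun1_integrable/integrableP: gL.
- apply: filterS (L1_classE (insubd 0 g)) => x /= + _ => ->//.
  by rewrite insubd_Lfun.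
Qed.

Lemma L1_integral_linear : linear L1_integral.
Proof.
move=> a f g; rewrite -(L1_of_rep f) -(L1_of_rep g).
set f' : T -> R := L1_rep f; set g' : T -> R := L1_rep g.
have fL : f' \in Lfun mu 1%E by exact: L1_fun_Lfun.
have gL : g' \in Lfun mu 1%E by exact: L1_fun_Lfun.
rewrite -L1_ofZ// -L1_ofD ?rpredZ// !L1_integral_of ?rpredD ?rpredZ//.
rewrite RintegralD//; [|by apply/Lfun1_integrable; rewrite rpredZ|exact/Lfun1_integrable].
by rewrite RintegralZl//; exact/Lfun1_integrable.
Qed.

HB.instance Definition _ :=
  GRing.isLinear.Build R (L1 mu) R^o _ L1_integral L1_integral_linear.

Lemma L1_integral_le f : `|L1_integral f| <= `|f|.
Proof.
rewrite -{2}(L1_of_rep f) L1_norm_of ?L1_fun_Lfun//.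
by apply: le_normr_Rintegral => //; apply/Lfun1_integrable; exact: L1_fun_Lfun.
Qed.

End L1_of.

(** * Functions of finitely many coordinates on the cube *)

Section cube.
Context {R : realType} {K : choiceType}.
Variable P : probability (sign_cube K) R.
Hypothesis P_unif : product_of_uniform P.
Implicit Types (s t : seq K) (h g : sign_cube K -> R) (k : K) (b : bool).

Definition depends_on s h := forall x y : K -> bool, {in s, x =1 y} -> h x = h y.

Definition upd (x : K -> bool) k b : K -> bool := fun j => if j == k then b else x j.

Lemma dep_sub s t h : {subset s <= t} -> depends_on s h -> depends_on t h.
Proof. by move=> st hs x y xy; apply: hs => k /st /xy. Qed.

Lemma dep_comp2 s h g (op : R -> R -> R) : depends_on s h -> depends_on s g ->
  depends_on s (fun x => op (h x) (g x)).
Proof. by move=> hs gs x y xy; rewrite (hs _ _ xy) (gs _ _ xy). Qed.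

Lemma dep_comp s h (op : R -> R) : depends_on s h -> depends_on s (op \o h).
Proof. by move=> hs x y xy /=; rewrite (hs _ _ xy). Qed.

Lemma dep_upd s h k b : depends_on (k :: s) h -> depends_on s (fun x => h (upd x k b)).
Proof.
move=> hs x y xy; apply: hs => j; rewrite inE /upd.
by case: (eqVneq j k) => //= _ /xy.
Qed.

Definition at_ k b : sign_cube K -> R := fun x => ((x : K -> bool) k == b)%:R.

Lemma dep_at k b s : k \in s -> depends_on s (at_ k b).
Proof. by move=> ks x y xy; rewrite /at_ xy. Qed.

(** Conditioning on one coordinate: both restrictions no longer depend on [k], which drives the
    inductions on the list of coordinates. *)
Lemma split_at k h x :
  h x = at_ k true x * h (upd x k true) + at_ k false x * h (upd x k false).
Proof.
have E b : (x : K -> bool) k = b -> upd x k b = x.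
  by move=> xk; apply/funext => j; rewrite /upd; case: eqP => // ->.
rewrite /at_; case xk : ((x : K -> bool) k); rewrite /= (E _ xk).
  by rewrite mul1r mul0r addr0.
by rewrite mul1r mul0r add0r.
Qed.

Lemma measurable_coord k (B : set bool) :
  measurable ([set x | B ((x : K -> bool) k)] : set (sign_cube K)).
Proof. by apply: sub_sigma_algebra; exists k, B. Qed.

Lemma measurable_at k b : measurable_fun setT (at_ k b).
Proof.
rewrite (_ : at_ k b = \1_([set x | (x : K -> bool) k = b] : set (sign_cube K))).
  by apply: measurable_indic; exact: (measurable_coord k [set b]).
apply/funext => x; rewrite /at_ indicE; congr (nat_of_bool _)%:R.
by apply/idP/idP => [/eqP xk|/set_mem/= ->//]; exact/mem_set.
Qed.

Lemma dep_measurable s h : depends_on s h -> measurable_fun setT h.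
Proof.
elim: s h => [|k s IH] h hs.
  rewrite (_ : h = cst (h (fun=> true))); first exact: measurable_cst.
  by apply/funext => x; apply: hs.
rewrite (funext (split_at k h)); apply: measurable_funD;
  apply: measurable_funM; by [exact: measurable_at|apply: IH; exact: dep_upd].
Qed.

Lemma dep_bounded s h : depends_on s h -> exists M, forall x, `|h x| <= M.
Proof.
elim: s h => [|k s IH] h hs.
  by exists `|h (fun=> true)| => x; rewrite (hs x (fun=> true)).
have [M HM] := IH _ (dep_upd true hs); have [N HN] := IH _ (dep_upd false hs).
exists (M + N) => x; rewrite (split_at k) (le_trans (ler_normD _ _))//.
have at1 b : `|at_ k b x| <= 1 by rewrite /at_; case: eqP; rewrite ?normr1 ?normr0.
by apply: lerD; rewrite normrM -[leRHS]mul1r ler_pM.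
Qed.

Lemma dep_Lfun s h : depends_on s h -> h \in Lfun P 1%E.
Proof.
move=> hs; have [M HM] := dep_bounded hs; apply/Lfun1_integrable.
apply: measurable_bounded_integrable => //.
- by rewrite -ge0_fin_numE ?fin_num_measure.
- exact: dep_measurable hs.
- exists M; split; first exact: num_real.
  by move=> N MN x _ /=; rewrite (le_trans (HM x))// ltW.
Qed.

Lemma dep_integrable s h : depends_on s h -> P.-integrable setT (EFin \o h).
Proof. by move=> /dep_Lfun/Lfun1_integrable. Qed.

Definition cylf t (sg : K -> bool) : sign_cube K -> R :=
  fun x => (all (fun k => (x : K -> bool) k == sg k) t)%:R.

Lemma dep_cylf t sg : depends_on t (cylf t sg).
Proof.
by move=> x y xy; congr (nat_of_bool _)%:R; apply: eq_in_all => k kt; rewrite xy.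
Qed.

Lemma integral_cylf t sg : uniq t -> \int[P]_x cylf t sg x = 2^-1 ^+ size t.
Proof.
move=> ut.
pose A : set (sign_cube K) := [set x | all (fun k => (x : K -> bool) k == sg k) t].
have cylE : cylf t sg = \1_A.
  apply/funext => x; rewrite /cylf indicE; congr (nat_of_bool _)%:R.
  by apply/idP/idP => [xk|/set_mem//]; exact/mem_set.
have mA : measurable A.
  apply/(@measurable_indicP _ _ R); rewrite -cylE.
  exact: dep_measurable (@dep_cylf t sg).
rewrite cylE /Rintegral integral_indic// setIT.
(* The cylinder is a rectangle with singleton sides, each of mass 1/2; [uniq t] provides the
   injectivity required by the product formula. *)
have := @P_unif (size t) (tnth (in_tuple t)) (fun j => [set sg (tnth (in_tuple t) j)]).
move=> /(_ (elimT (tuple_uniqP (in_tuple t)) ut)).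
rewrite (eq_bigr (fun=> (2^-1)%:E)); last first.
  move=> j _; rewrite /bernoulli_prob invr_ge0 ler0n invf_le1 ?ltr0n// ler1n /=.
  rewrite fsbig_set1 /bernoulli_pmf; case: (sg _) => //.
  by rewrite /unstable.onem; congr EFin; lra.
rewrite prodEFin prodr_const card_ord => Pt.
suff -> : A = [set x | forall j, [set sg (tnth (in_tuple t) j)]
    ((x : K -> bool) (tnth (in_tuple t) j))] by exact: (congr1 fine Pt).
apply/seteqP; split => x /=.
  by move=> /allP xA j; apply/eqP/xA/mem_tnth.
by move=> xA; apply/allP => k /(tnthP (in_tuple t))[j ->]; apply/eqP.
Qed.

Lemma cylf_cons k t sg x :
  cylf (k :: t) sg x = at_ k (sg k) x * cylf t sg x.
Proof. by rewrite /cylf /at_ /= -natrM mulnb. Qed.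

(** Independence of disjoint sets of coordinates. By induction on [s], with [t] and [sg] varying:
    after conditioning [h] on [k], the factor [at_ k] is absorbed into the cylinder. *)
Lemma integral_dep_cylf s h t sg :
  depends_on s h -> uniq t -> {in s, forall k, k \notin t} ->
  \int[P]_x (h x * cylf t sg x) = 2^-1 ^+ size t * \int[P]_x h x.
Proof.
elim: s h t sg => [|k s IH] h t sg hs ut st.
  have -> : h = cst (h (fun=> true)) by apply/funext => x; apply: hs.
  rewrite /= RintegralZl//; last exact: dep_integrable (@dep_cylf t sg).
  rewrite integral_cylf// Rintegral_cst// (_ : fine _ = 1); first by rewrite mulr1 mulrC.
  exact: (congr1 fine (probability_setT P)).
have [ks|ks] := boolP (k \in s).
  apply: IH => //; last by move=> j js; apply: st; rewrite inE js orbT.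
  by apply: dep_sub hs => j; rewrite inE => /orP[/eqP ->|].
have kt : k \notin t by apply: st; rewrite inE eqxx.
have hb b := dep_upd b hs.
(* Stated for an arbitrary list [u], so that [t] yields the left-hand side and the empty list yields
   the integral of [h] alone. *)
have split_int u tau : k \notin u -> {in s, forall j, j \notin u} -> uniq u ->
    \int[P]_x (h x * cylf u tau x) =
    2^-1 ^+ (size u).+1 * (\int[P]_x h (upd x k true) + \int[P]_x h (upd x k false)).
  move=> ku su uu.
  have E x : h x * cylf u tau x =
     h (upd x k true) * cylf (k :: u) (upd tau k true) x +
     h (upd x k false) * cylf (k :: u) (upd tau k false) x.
    have ucyl b : cylf u (upd tau k b) x = cylf u tau x.
      congr (nat_of_bool _)%:R; apply: eq_in_all => j ju; rewrite /upd.
      have /negbTE -> // : j != k by apply: contraNneq ku => <-.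
    rewrite !cylf_cons !ucyl /upd eqxx {1}(split_at k h x) /upd; ring.
  have dint b : P.-integrable setT
      (EFin \o (fun x => h (upd x k b) * cylf (k :: u) (upd tau k b) x)).
    apply: (@dep_integrable (s ++ (k :: u))); apply: dep_comp2.
      by apply: dep_sub (hb b) => j js; rewrite mem_cat js.
    by apply: dep_sub (@dep_cylf _ _) => j ju; rewrite mem_cat ju orbT.
  under eq_Rintegral do rewrite E.
  rewrite RintegralD// !IH ?mulrDr//=; rewrite ?ku//.
  - by move=> j js; rewrite inE negb_or su// andbT; apply: contraNneq ks => <-.
  - by move=> j js; rewrite inE negb_or su// andbT; apply: contraNneq ks => <-.
rewrite split_int//; last by move=> j js; apply: st; rewrite inE js orbT.
have -> : \int[P]_x h x = \int[P]_x (h x * cylf [::] sg x).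
  by apply: eq_Rintegral => x _; rewrite /cylf /= mulr1.
by rewrite split_int//= expr1 exprS mulrA [2^-1 * _]mulrC.
Qed.

Lemma integral_at s h k b : depends_on s h -> k \notin s ->
  \int[P]_x (h x * at_ k b x) = 2^-1 * \int[P]_x h x.
Proof.
move=> hs ks; rewrite -(expr1 2^-1) -(@integral_dep_cylf s h [:: k] (fun=> b))//.
  by apply: eq_Rintegral => x _; rewrite /cylf /= andbT.
by move=> j js; rewrite inE; apply: contraNneq ks => <-.
Qed.

End cube.

(** Taking maxima is nonexpansive, so approximations of two indicators give one of the indicator of
    the union. *)
Lemma ler_dist_max (R : realDomainType) (a b c d : R) :
  `|Num.max a b - Num.max c d| <= `|a - c| + `|b - d|.
Proof.
have := (ler_norm (a - c), ler_norm (b - d), ler_norm (- (a - c)), ler_norm (- (b - d))).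
rewrite !normrN => -[[[ac bd] ca] db].
have [n1 n2] := (normr_ge0 (a - c), normr_ge0 (b - d)).
by rewrite ler_norml; case: (leP a b) => ?; case: (leP c d) => ?; apply/andP; split; lra.
Qed.

(** * Density in L_1 of the functions of finitely many coordinates *)

Section dense.
Import HBSimple.
Context {R : realType} {K : choiceType}.
Variable P : probability (sign_cube K) R.
Implicit Types (s t : seq K) (h g : sign_cube K -> R) (f : L1 P) (A : set (sign_cube K)).

Definition dep_limit f := forall e : R, 0 < e ->
  exists s h, depends_on s h /\ `|f - L1_of P h| < e.

Lemma dep_limit_dep s h : depends_on s h -> dep_limit (L1_of P h).
Proof. by move=> hs e e0; exists s, h; rewrite subrr normr0. Qed.

Lemma dep_limitD f f' : dep_limit f -> dep_limit f' -> dep_limit (f + f').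
Proof.
move=> fl fl' e e0.
have e20 : 0 < e / 2 by rewrite divr_gt0.
have [s [h [hs fh]]] := fl _ e20; have [t [g [gt fg]]] := fl' _ e20.
have hs' : depends_on (s ++ t) h by apply: dep_sub hs => k ks; rewrite mem_cat ks.
have gt' : depends_on (s ++ t) g by apply: dep_sub gt => k kt; rewrite mem_cat kt orbT.
exists (s ++ t), (h + g); split; first exact: dep_comp2.
rewrite L1_ofD ?(dep_Lfun P hs')//; last exact: dep_Lfun gt'.
rewrite opprD addrACA (le_lt_trans (ler_normD _ _))//.
by rewrite [e]splitr ltrD.
Qed.

Lemma dep_limitZ a f : dep_limit f -> dep_limit (a *: f).
Proof.
move=> fl e e0.
have ea0 : 0 < e / (`|a| + 1) by rewrite divr_gt0// ltr_wpDl.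
have [s [h [hs fh]]] := fl _ ea0.
exists s, (a *: h); split; first exact: (dep_comp ( *%R a) hs).
rewrite L1_ofZ; last exact: dep_Lfun hs.
rewrite -scalerBr normrZ.
have : (`|a| + 1) * `|f - L1_of P h| < e.
  by rewrite mulrC -ltr_pdivlMr// ltr_wpDl.
by apply: le_lt_trans; rewrite ler_wpM2r// lerDl.
Qed.

Lemma dep_limit_closed f :
  (forall e : R, 0 < e -> exists2 f', dep_limit f' & `|f - f'| < e) -> dep_limit f.
Proof.
move=> fl e e0.
have e20 : 0 < e / 2 by rewrite divr_gt0.
have [f' fl' ff'] := fl _ e20; have [s [h [hs fh]]] := fl' _ e20.
exists s, h; split => //.
by rewrite -(subrKA f') (le_lt_trans (ler_normD _ _))// [e]splitr ltrD.
Qed.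

Let ind A : L1 P := L1_of P (\1_A : _ -> R).

Lemma indic_Lfun A : measurable A -> (\1_A : sign_cube K -> R) \in Lfun P 1%E.
Proof. by move=> mA; apply/Lfun1_integrable; exact: integrable_indic. Qed.

Let dep_limitU A B : measurable A -> measurable B ->
  dep_limit (ind A) -> dep_limit (ind B) -> dep_limit (ind (A `|` B)).
Proof.
move=> mA mB Al Bl e e0.
have e20 : 0 < e / 2 by rewrite divr_gt0.
have [s [h [hs fh]]] := Al _ e20; have [t [g [gt fg]]] := Bl _ e20.
have hs' : depends_on (s ++ t) h by apply: dep_sub hs => k ks; rewrite mem_cat ks.
have gt' : depends_on (s ++ t) g by apply: dep_sub gt => k kt; rewrite mem_cat kt orbT.
pose m := fun x => Num.max (h x) (g x).
have mst : depends_on (s ++ t) m by exact: dep_comp2.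
have hL := dep_Lfun P hs'; have gL := dep_Lfun P gt'; have mL := dep_Lfun P mst.
have AL := indic_Lfun mA; have BL := indic_Lfun mB.
have UL := indic_Lfun (measurableU _ _ mA mB).
exists (s ++ t), m; split => //.
apply: (@le_lt_trans _ _ (`|ind A - L1_of P h| + `|ind B - L1_of P g|)); last first.
  by rewrite [e]splitr ltrD.
rewrite /ind -!L1_ofB// !L1_norm_of ?rpredB// -RintegralD//.
- apply: le_Rintegral => //.
  + by apply/Lfun1_integrable/Lfun_norm; rewrite rpredB.
  + apply/Lfun1_integrable.
    by apply: (@rpredD _ (Lfun P 1%E)); apply: Lfun_norm; rewrite rpredB.
  + move=> x _; rewrite /= !fctE /m.
    suff -> : \1_(A `|` B) x = Num.max (\1_A x) (\1_B x) :> R by exact: ler_dist_max.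
    rewrite !indicE in_setU.
    case: (x \in A); case: (x \in B) => /=; rewrite ?maxxx//.
      by rewrite max_l.
    by rewrite max_r.
- by apply/Lfun1_integrable/Lfun_norm; rewrite rpredB.
- by apply/Lfun1_integrable/Lfun_norm; rewrite rpredB.
Qed.

Let dep_limitC A : measurable A -> dep_limit (ind A) -> dep_limit (ind (~` A)).
Proof.
move=> mA Al.
have -> : ind (~` A) = L1_of P (cst 1) + (-1) *: ind A.
  have cL : (cst 1 : sign_cube K -> R) \in Lfun P 1%E by apply: (@dep_Lfun _ _ _ [::]).
  rewrite scaleN1r -L1_ofB//; last exact: indic_Lfun.
  congr L1_of; apply/funext => x; rewrite !fctE !indicE in_setC.
  by case: (x \in A); rewrite /= ?subrr ?subr0.
apply: dep_limitD; last exact: dep_limitZ.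
exact: (@dep_limit_dep [::]).
Qed.

(** The finite unions increase to the countable one, and the L_1 distance of their indicators is a
    difference of measures, which tends to 0 by continuity from below. *)
Let dep_limit_bigcup (A : (set (sign_cube K))^nat) :
  (forall n, measurable (A n)) -> (forall n, dep_limit (ind (A n))) ->
  dep_limit (ind (\bigcup_n A n)).
Proof.
move=> mA Al.
pose B n := \big[setU/set0]_(i < n.+1) A i.
have mB n : measurable (B n) by exact: bigsetU_measurable.
have Bl n : dep_limit (ind (B n)).
  rewrite /B; elim: n => [|n IH]; first by rewrite big_ord1.
  by rewrite big_ord_recr; apply: dep_limitU => //; exact: mB.
have mU : measurable (\bigcup_n A n) by exact: bigcup_measurable.
have BU n : B n `<=` \bigcup_n A n by exact: bigsetU_bigcup.
have cvB : P \o B @ \oo --> P (\bigcup_n A n).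
  rewrite -bigcup_bigsetU_bigcup; apply: nondecreasing_cvg_mu => //.
    by rewrite bigcup_bigsetU_bigcup.
  by move=> m n mn; rewrite subsetEset; apply: subset_bigsetU; rewrite ltnS.
apply: dep_limit_closed => e e0.
have [n Pn] : exists n, `|fine (P (\bigcup_n A n)) - fine (P (B n))| < e.
  have : fine \o P \o B @ \oo --> fine (P (\bigcup_n A n)).
    apply: fine_cvg; rewrite fineK//; exact: fin_num_measure.
  by move=> /cvgrPdist_lt/(_ _ e0)[N _ /(_ N (leqnn N)) NP]; exists N.
exists (ind (B n)) => //; apply: le_lt_trans Pn.
have UL := indic_Lfun mU; have BL := indic_Lfun (mB n).
rewrite /ind -L1_ofB// L1_norm_of ?rpredB//.
have -> : fine (P (\bigcup_n A n)) = \int[P]_x (\1_(\bigcup_n A n) x).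
  by rewrite /Rintegral integral_indic// setIT.
have -> : fine (P (B n)) = \int[P]_x (\1_(B n) x).
  by rewrite /Rintegral integral_indic// setIT.
rewrite -RintegralB//; [|exact/Lfun1_integrable..].
rewrite le_eqVlt; apply/orP; left; apply/eqP.
rewrite ger0_norm.
  apply: eq_Rintegral => x _; rewrite /= !fctE ger0_norm// subr_ge0 !indicE ler_nat.
  have [xB|//] := boolP (x \in B n).
  by rewrite (mem_set (BU n _ (set_mem xB))).
apply: Rintegral_ge0 => x _.
rewrite subr_ge0 !indicE ler_nat; have [xB|//] := boolP (x \in B n).
by rewrite (mem_set (BU n _ (set_mem xB))).
Qed.

(** The measurable sets whose indicator is a limit form a sigma-algebra containing the generators.
    Measurability is carried along because the closure steps need it. *)
Lemma dep_limit_indic A : measurable A -> dep_limit (ind A).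
Proof.
move=> mA; suff [] : measurable A /\ dep_limit (ind A) by [].
move: A mA; apply: smallest_sub.
  split.
  - split; first exact: measurable0.
    rewrite /ind indic0; exact: (@dep_limit_dep [::]).
  - by move=> A [mA Al]; rewrite setTD; split; [exact: measurableC|exact: dep_limitC].
  - move=> F FP; split; first by apply: bigcup_measurable => k _; exact: (FP k).1.
    by apply: dep_limit_bigcup => k; case: (FP k).
move=> A [k [B ->]]; split; first exact: measurable_coord.
apply: (@dep_limit_dep [:: k]) => x y xy; rewrite !indicE; congr (nat_of_bool _)%:R.
have xyk := xy _ (mem_head k [::]).
by apply/idP/idP => /set_mem /= H; apply/mem_set => /=; [rewrite -xyk|rewrite xyk].
Qed.

Lemma dep_limit_sfun (g : {sfun sign_cube K >-> R}) : dep_limit (L1_of P g).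
Proof.
rewrite (_ : (g : _ -> R) =
    \sum_(y <- finmap.enum_fset (fset_set (range g))) y *: \1_(g @^-1` [set y])); last first.
  apply/funext => x; rewrite fimfunE fsbig_finite//= fct_sumE.
  by apply: eq_bigr => y _.
elim: (finmap.enum_fset _) => [|y r IH].
  by rewrite big_nil; apply: (@dep_limit_dep [::]).
have m1 z : (\1_(g @^-1` [set z]) : sign_cube K -> R) \in Lfun P 1%E.
  by apply: indic_Lfun; rewrite -[X in measurable X]setTI; exact: measurable_funP.
rewrite big_cons L1_ofD ?rpredZ// ?rpred_sum//; last by move=> z _; rewrite rpredZ.
apply: dep_limitD => //; rewrite L1_ofZ//; apply: dep_limitZ; apply: dep_limit_indic.
by rewrite -[X in measurable X]setTI; exact: measurable_funP.
Qed.

Lemma dep_dense f : dep_limit f.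
Proof.
apply: dep_limit_closed => e e0.
have fi : P.-integrable setT (EFin \o L1_rep f) by exact/Lfun1_integrable/L1_fun_Lfun.
have [g [gi _ /fine_cvgP[_ cvg0]]] := approximation_sfun_integrable measurableT fi.
have [N _ /(_ N (leqnn N)) NP] := (cvgrPdist_lt _ _).1 cvg0 _ e0.
exists (L1_of P (g N)); first exact: dep_limit_sfun.
have gL : (g N : _ -> R) \in Lfun P 1%E by exact/Lfun1_integrable.
rewrite -{1}(L1_of_rep f) -L1_ofB//; last exact: L1_fun_Lfun.
rewrite L1_norm_of ?rpredB//; last exact: L1_fun_Lfun.
apply: le_lt_trans NP; rewrite sub0r normrN; apply: ler_norm.
Qed.

End dense.

(** * A dense family of rational tables *)

Section coded.
Context {R : realType} {K : choiceType}.
Variable P : probability (sign_cube K) R.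

Lemma L1_of_dist_le s t (h g : sign_cube K -> R) e : depends_on s h -> depends_on t g ->
  (forall x, `|h x - g x| <= e) -> `|L1_of P h - L1_of P g| <= e.
Proof.
move=> hs gt hg; have hL := dep_Lfun P hs; have gL := dep_Lfun P gt.
rewrite -L1_ofB// L1_norm_of ?rpredB//.
have -> : e = \int[P]_x (cst e x).
  rewrite Rintegral_cst// (_ : fine _ = 1) ?mulr1//.
  exact: (congr1 fine (probability_setT P)).
apply: le_Rintegral => //.
- by apply/Lfun1_integrable/Lfun_norm; rewrite rpredB.
- by apply: (@dep_integrable _ _ _ [::]).
- by move=> x _; exact: hg.
Qed.

(* [c.2] lists rational values at the [pickle]-codes of the sign patterns on the
   coordinates [c.1]; there are only #|K| such [c]. *)
Definition table (c : seq K * seq rat) : sign_cube K -> R :=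
  fun x => ratr (nth 0%Q c.2 (pickle (map (x : K -> bool) c.1))).

Lemma dep_table c : depends_on c.1 (table c).
Proof.
move=> x y xy; rewrite /table; congr (ratr (nth _ _ _)).
by congr pickle; apply/eq_in_map => k; exact: xy.
Qed.

Lemma table_dense (f : L1 P) (e : R) : 0 < e ->
  exists c, `|f - L1_of P (table c)| < e.
Proof.
move=> e0; have e20 : 0 < e / 2 by rewrite divr_gt0.
have [s [h [hs fh]]] := dep_dense f e20.
(* A sign pattern on [s] becomes a point of the cube, with value [false] off [s]. *)
pose pt (p : seq bool) : K -> bool := fun k => nth false p (index k s).
have /choice[q qP] : forall p, exists r : rat, `|h (pt p) - ratr r| <= e / 2.
  move=> p; have [|r] := @rat_in_itvoo R (h (pt p)) (h (pt p) + e / 2).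
    by rewrite ltrDl.
  rewrite in_itv /= => /andP[hr rh]; exists r.
  by rewrite ler_norml; apply/andP; split; lra.
(* One more than the largest code of a pattern on [s], so that the lookup in [t] never leaves the
   list; entries that are no code receive 0. *)
pose N := (\max_(p : (size s).-tuple bool) pickle (tval p)).+1.
pose t := mkseq (fun j => if unpickle j is Some p then q p else 0%Q) N.
exists (s, t); rewrite -(subrKA (L1_of P h)) (le_lt_trans (ler_normD _ _))//.
rewrite [ltRHS]splitr ltr_leD//.
apply: (L1_of_dist_le hs (@dep_table (s, t))) => x.
have -> : h x = h (pt (map (x : K -> bool) s)).
  apply: hs => k ks; rewrite /pt (nth_map k) ?index_mem//.
  by rewrite nth_index.
rewrite /table nth_mkseq ?pickleK//.
rewrite /N ltnS (leq_bigmax_cond (map_tuple (x : K -> bool) (in_tuple s)))//.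
Qed.

End coded.

(** For nonzero [x], the condition [t * |x| < f x] says that the normalized [x] satisfies [f > t].
    This homogeneous form of a slice postpones all normalization, and here it is shown to be
    open. *)
Lemma lt_linear_open (R : realType) (V : normedModType R) (f : {linear V -> R^o})
    (M t : R) (x : V) :
  (forall y, `|f y| <= M * `|y|) -> t * `|x| < f x ->
  exists2 e : R, 0 < e & forall y, `|x - y| < e -> t * `|y| < f y.
Proof.
(* The difference of the two sides is Lipschitz with constant [|M| + |t|]; the added 1 makes the
   divisor positive. *)
move=> fM fx; pose N := `|M| + `|t| + 1.
have N0 : 0 < N by rewrite ltr_wpDl// addr_ge0.
exists ((f x - t * `|x|) / N); first by rewrite divr_gt0// subr_gt0.
move=> y; rewrite ltr_pdivlMr// => xy.
have fxy : f x - f y <= `|M| * `|x - y|.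
  rewrite -linearB (le_trans (ler_norm _))// (le_trans (fM _))//.
  by rewrite ler_wpM2r// ler_norm.
have txy : t * (`|y| - `|x|) <= `|t| * `|x - y|.
  rewrite (le_trans (ler_norm _))// normrM ler_wpM2l// distrC.
  exact: ler_dist_dist.
have := normr_ge0 (x - y); rewrite /N in xy; nra.
Qed.

(** * Coordinates in l_1-sums *)

Section l1_coordinates.
Context {R : realType} {I : choiceType}.
Variable X : I -> normedModType R.
Implicit Types (x y : l1_sum X).

Lemma l1_in_subproof i (u : X i) :
  (\esum_(j in [set: I]) `|eqtype.dfwith (fun j => 0 : X j) u j|%:E < +oo)%E.
Proof.
rewrite (esumID [set i])//.
rewrite !setTI esum_set1 ?lee_fin// [X in (_ + X)%E]esum1.
  by rewrite adde0 ltry.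
by move=> j /= ij; rewrite dfwith_out ?normr0//; apply/eqP => ji; exact: ij.
Qed.

Definition l1_in i (u : X i) : l1_sum X := L1Sum (l1_in_subproof u).

Lemma l1_in_eq i (u : X i) : l1_in u i = u.
Proof. exact: dfwith_in. Qed.

Lemma l1_in_neq i j (u : X i) : i != j -> l1_in u j = 0.
Proof. by move=> ij; apply: dfwith_out. Qed.

Lemma l1_in_linear i : linear (@l1_in i).
Proof.
move=> a u v; apply: l1_sumP => j.
change (l1_in (a *: u + v) j = a *: l1_in u j + l1_in v j).
have [ij|ij] := eqVneq i j; first by subst j; rewrite !l1_in_eq.
by rewrite !l1_in_neq// scaler0 addr0.
Qed.

HB.instance Definition _ i :=
  GRing.isLinear.Build R (X i) (l1_sum X) _ (@l1_in i) (@l1_in_linear i).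

(** The sum is cut into the index [i] and the other indices, where the remainder agrees with [x]. *)
Lemma l1_normr_split i x : `|x| = `|x i| + `|x - l1_in (x i)|.
Proof.
apply: EFin_inj; rewrite EFinD [LHS]l1_normE [X in (_ = _ + X)%E]l1_normE.
rewrite (esumID [set i])//.
rewrite setTI esum_set1 ?lee_fin//; congr (_ + _)%E.
rewrite [RHS](esumID [set i])//.
rewrite [in RHS]setTI esum_set1 ?lee_fin//.
have -> : (x - l1_in (x i)) i = 0.
  by change (x i - l1_in (x i) i = 0); rewrite l1_in_eq subrr.
rewrite normr0 add0e; apply: eq_esum => j [_ /= ji].
change (`|x j|%:E = `|x j - l1_in (x i) j|%:E).
by rewrite l1_in_neq ?subr0//; apply/eqP => ij; exact: ji.
Qed.

Lemma l1_norm_in i (u : X i) : `|l1_in u| = `|u|.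
Proof. by rewrite (l1_normr_split i) l1_in_eq subrr normr0 addr0. Qed.

Lemma l1_normD_in i x (u : X i) :
  `|x + l1_in u| = `|x i + u| + `|x - l1_in (x i)|.
Proof.
rewrite (l1_normr_split i).
have -> : (x + l1_in u) i = x i + u.
  by change (x i + l1_in u i = x i + u); rewrite l1_in_eq.
by congr (_ + `|_|); rewrite raddfD opprD addrACA subrr addr0.
Qed.

Lemma l1_coord_sum (s : seq I) x j :
  (\sum_(i <- s) l1_in (x i)) j = \sum_(i <- s) l1_in (x i) j.
Proof. by rewrite (big_morph (fun y : l1_sum X => y j) (id1 := 0) (op1 := +%R)). Qed.

Lemma l1_coord_notin (s : seq I) x j : j \notin s ->
  (\sum_(i <- s) l1_in (x i)) j = 0.
Proof.
move=> js; rewrite l1_coord_sum big1_seq// => i /andP[_ si].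
by rewrite l1_in_neq//; apply: contraNneq js => <-.
Qed.

Lemma l1_norm_sub_sum (s : seq I) x : uniq s ->
  `|x - \sum_(i <- s) l1_in (x i)| = `|x| - \sum_(i <- s) `|x i|.
Proof.
elim: s => [|i s IH] /=; first by rewrite !big_nil !subr0.
move=> /andP[iNs us]; rewrite !big_cons.
set y := x - \sum_(j <- s) l1_in (x j).
have yi : y i = x i.
  change (x i - (\sum_(j <- s) l1_in (x j)) i = x i).
  by rewrite l1_coord_notin ?subr0.
have -> : x - (l1_in (x i) + \sum_(j <- s) l1_in (x j)) = y - l1_in (x i).
  by rewrite opprD addrCA addrC.
by have := l1_normr_split i y; rewrite yi (IH us); lra.
Qed.

Lemma l1_norm_sum (s : seq I) x : uniq s ->
  `|\sum_(i <- s) l1_in (x i)| = \sum_(i <- s) `|x i|.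
Proof.
elim: s => [|i s IH] /=; first by rewrite !big_nil normr0.
move=> /andP[iNs us]; rewrite !big_cons addrC l1_normD_in l1_coord_notin// add0r.
by rewrite raddf0 subr0 IH.
Qed.

(** The norm is a supremum of finite partial sums; the distance to a nearly optimal one is the
    missing mass. *)
Lemma l1_finite_dense x (e : R) : 0 < e ->
  exists2 s, uniq s & `|x - \sum_(i <- s) l1_in (x i)| < e.
Proof.
move=> e0.
have sfin : (\esum_(i in [set: I]) `|x i|%:E)%E \is a fin_num.
  by rewrite -l1_normE.
have [_ [A [finA _] <-]] := ub_ereal_sup_adherent e0 sfin.
rewrite -[ereal_sup _]/(\esum_(i in [set: I]) `|x i|%:E)%E -l1_normE.
rewrite fsbig_finite//= sumEFin -EFinB lte_fin => xA.
exists (finmap.enum_fset (fset_set A)); first exact: finmap.fset_uniq.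
rewrite l1_norm_sub_sum ?finmap.fset_uniq//.
by rewrite ltrBlDr addrC -ltrBlDr.
Qed.

(** By openness [x] may be replaced by a finite sum of its coordinates. Norm and functional are both
    additive over that sum, so the strict inequality survives at some coordinate. *)
Lemma lt_linear_coordinate (f : {linear l1_sum X -> R^o}) (M t : R) x :
  (forall y, `|f y| <= M * `|y|) -> t * `|x| < f x ->
  exists i (u : X i), t * `|u| < f (l1_in u).
Proof.
move=> fM /(lt_linear_open fM)[e e0 fe].
have [s us /fe] := l1_finite_dense x e0.
apply: contraPP => /forallNP nf; apply/negP.
rewrite -leNgt l1_norm_sum// linear_sum mulr_sumr.
by apply: ler_sum => i _; rewrite leNgt; apply/negP => tu; apply: (nf i); exists (x i).
Qed.

End l1_coordinates.

(** * Bounded functionals and transfer along isometries *)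

Lemma continuous_linear_le (R : realType) (V : normedModType R) (f : {linear V -> R^o}) :
  continuous f -> exists2 M : R, 0 < M & forall x, `|f x| <= M * `|x|.
Proof.
move=> fc; have := continuous_linear_bounded 0 (fc 0).
by move=> /linear_boundedP/pinfty_ex_gt0[M M0 fM]; exists M.
Qed.

Lemma linear_le_continuous (R : realType) (V : normedModType R) (W : normedModType R)
    (f : {linear V -> W}) (M : R) :
  (forall x, `|f x| <= M * `|x|) -> continuous f.
Proof.
move=> fM; apply: bounded_linear_continuous; apply/linear_boundedP.
by near=> r => x; rewrite (le_trans (fM x))// ler_wpM2r.
Unshelve. all: by end_near. Qed.

Lemma isometrically_isomorphic_sym (R : realType) (X Y : normedModType R) :
  isometrically_isomorphic X Y -> isometrically_isomorphic Y X.
Proof.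
move=> [T [[S TS ST] Tn]].
have Slin : linear S.
  by move=> a x y; apply: (can_inj TS); rewrite linearP !ST.
pose Sl : {linear Y -> X} := HB.pack S (GRing.isLinear.Build R Y X _ S Slin).
exists Sl; split; first by exists T.
by move=> y; rewrite -Tn; congr `|_|; exact: ST.
Qed.

Lemma Daugavet_property_isom (R : realType) (X Y : normedModType R) (K : Type) :
  isometrically_isomorphic X Y -> Daugavet_property X K -> Daugavet_property Y K.
Proof.
move=> XY DX; have [S [[T ST TS] Sn]] := isometrically_isomorphic_sym XY.
have Tn x : `|T x| = `|x| by rewrite -Sn TS.
have Tlin : linear T.
  by move=> a x y; apply: (can_inj ST); rewrite linearP !TS.
pose Tl : {linear X -> Y} := HB.pack T (GRing.isLinear.Build R X Y _ T Tlin).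
move=> B f alpha eps BS BK fc a0 e0.
have [M M0 fM] := continuous_linear_le fc.
pose fT : {linear X -> R^o} := (f \o Tl)%FUN.
have fTc : continuous fT.
  by apply: (@linear_le_continuous _ _ _ _ M) => x /=; rewrite (le_trans (fM _))// Tn.
have [||x [xB fx] xeps] := DX (S @` B) fT alpha eps _ _ fTc a0 e0.
- by move=> _ [y /BS + <-]; rewrite /unit_sphere /= Sn.
- exact: card_le_trans (card_image_le _ _) BK.
exists (T x).
  split; first by rewrite /unit_ball /= Tn.
  (* The slices correspond because [T] maps one unit ball onto the other, so both suprema agree. *)
  suff <- : fT @` @unit_ball _ X = f @` @unit_ball _ Y by [].
  apply/seteqP; split => [_ [z zB <-]|_ [z zB <-]].
    by exists (T z) => //; rewrite /unit_ball /= Tn.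
  by exists (S z); [rewrite /unit_ball /= Sn|rewrite /= ST].
by move=> y By; rewrite -Sn linearD TS; apply: xeps; exists y.
Qed.

(** * Upper bound *)

Lemma dist_normalize (R : realType) (V : normedModType R) (v : V) :
  v != 0 -> `| `|v|^-1 *: v - v| = `|1 - `|v| |.
Proof.
move=> v0; rewrite -{3}[v]scale1r -scalerBl normrZ.
rewrite -[X in _ * X](ger0_norm (normr_ge0 v)) -normrM.
by rewrite mulrBl mulVf ?normr_eq0// mul1r.
Qed.

(** The norm of [v] lies between 5/8 and 9/8, so normalizing moves [v] by at most 3/8; adding the
    initial error 1/8 gives 1/2. *)
Lemma normalize_near_opp (R : realType) (V : normedModType R) (x v : V) :
  3 / 4 < `|x| -> `|x| <= 1 -> `|(- x) - v| < 8^-1 ->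
  v != 0 /\ `|x + `|v|^-1 *: v| <= 2^-1.
Proof.
move=> x3 x1 xv.
have := ler_dist_dist (- x) v; rewrite normrN => /le_lt_trans/(_ xv).
rewrite ltr_norml => /andP[v1 v2].
have v0 : v != 0 by rewrite -normr_gt0; lra.
split => //.
have : `|x + `|v|^-1 *: v| <= `| `|v|^-1 *: v - v| + `|(- x) - v|.
  rewrite -[X in _ <= _ + X]normrN opprB opprK.
  by rewrite (le_trans _ (ler_normD _ _))// addrA subrK addrC.
have : `|1 - `|v| | <= 3 / 8 by rewrite ler_norml; apply/andP; split; lra.
by rewrite dist_normalize//; lra.
Qed.

Section upper.
Context {R : realType} {Lambda : choiceType}.
Variables (kappa : Lambda -> choiceType)
  (P : forall l, probability (sign_cube (kappa l)) R).
Let X := l1_sum (fun l => L1 (P l)).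

Let coord_integral l (x : X) : R^o := L1_integral (x l).

Let coord_integral_linear l : linear (@coord_integral l).
Proof. by move=> a x y; rewrite -[RHS]linearP. Qed.

HB.instance Definition _ l :=
  GRing.isLinear.Build R X R^o _ (@coord_integral l) (@coord_integral_linear l).

Lemma norm_coord_le l (x : X) : `|x l| <= `|x|.
Proof. by rewrite (l1_normr_split l) lerDl. Qed.

Lemma not_Daugavet_sum l : infinite_set [set: kappa l] ->
  ~ Daugavet_property X (kappa l).
Proof.
move=> kinf.
pose tab c : L1 (P l) := L1_of (P l) (@table R (kappa l) c).
pose Y : set X :=
  [set l1_in (`|tab c|^-1 *: tab c) | c in [set c | tab c != 0]].
have YS : Y `<=` @unit_sphere R X.
  move=> _ [c c0 <-]; rewrite /unit_sphere /= l1_norm_in normrZ.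
  by rewrite normfV normr_id mulVf ?normr_eq0.
have YK : (Y #<= [set: kappa l])%card.
  apply: card_le_trans (card_image_le _ _) _.
  apply: card_le_trans (card_leT _) _.
  apply/embedsP/embeds_prod => //.
    by apply: embeds_seq => //; exists id.
  exact: embeds_countType.
have fle (x : X) : `|coord_integral l x| <= 1 * `|x|.
  by rewrite mul1r (le_trans (L1_integral_le _))// norm_coord_le.
have fc : continuous (@coord_integral l) by exact: linear_le_continuous fle.
(* The slice has width 1/4 and the property is tested with eps = 1/2. *)
have [a0 e0] : 0 < 4^-1 :> R /\ 0 < 2^-1 :> R by rewrite !invr_gt0.
move=> /(_ Y (@coord_integral l) _ _ YS YK fc a0 e0)[x [xB fx] xY].
(* The constant function 1 in the summand [l] has norm and integral 1. *)
have sup1 : 1 <= sup (@coord_integral l @` @unit_ball R X).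
  have oneL : (cst 1 : sign_cube (kappa l) -> R) \in Lfun (P l) 1%E.
    by apply: (@dep_Lfun _ _ _ [::]).
  have P1 : \int[P l]_y (cst 1 y) = 1.
    rewrite Rintegral_cst// mul1r.
    exact: (congr1 fine (probability_setT (P l))).
  apply: ub_le_sup.
    exists 1 => _ [z zB <-]; rewrite (le_trans (ler_norm _))// (le_trans (fle _))//.
    by rewrite mul1r.
  exists (l1_in (L1_of (P l) (cst 1))).
    rewrite /unit_ball /= l1_norm_in L1_norm_of//.
    by under eq_Rintegral do rewrite normr1; rewrite P1.
  by rewrite /coord_integral l1_in_eq L1_integral_of.
have fx1 := L1_integral_le (x l).
have xl : 3 / 4 < `|x l|.
  apply: lt_le_trans (le_trans (ler_norm _) fx1).
  apply: le_lt_trans fx; apply: le_trans (lerB sup1 (lexx _)); lra.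
have e8 : 0 < 8^-1 :> R by rewrite invr_gt0.
have [c vx] := table_dense (- x l) e8.
have xl1 : `|x l| <= 1 := le_trans (norm_coord_le l x) xB.
have [v0 vxl] := normalize_near_opp xl xl1 vx.
have /= := xY (l1_in (`|tab c|^-1 *: tab c)); rewrite [_ + x]addrC l1_normD_in.
move=> /(_ (ex_intro2 _ _ c v0 erefl)); apply/negP; rewrite -leNgt.
have -> : `|x - l1_in (x l)| = `|x| - `|x l|.
  by rewrite (l1_normr_split l x) addrAC subrr add0r.
(* The summand [l] contributes at most 1/2 and the others at most 1 - 3/4, well below 2 - 1/2. *)
apply: le_trans (lerD vxl (lerB xB (ltW xl))) _; lra.
Qed.

End upper.

(** * Lower bound *)

Lemma small_power_half (R : realType) (e : R) : 0 < e -> exists n, 2^-1 ^+ n < e.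
Proof.
move=> e0; exists (Num.bound e^-1).
have := upper_nthrootP (leqnn (Num.bound e^-1)).
by rewrite exprVn -[ltRHS]invrK ltf_pV2 ?posrE ?exprn_gt0 ?invr_gt0.
Qed.

Section cube_lower.
Context {R : realType} {K : choiceType}.
Variable P : probability (sign_cube K) R.
Hypothesis P_unif : product_of_uniform P.
Hypothesis Kinf : infinite_set [set: K].

(** Overlap is measured on the support rather than through values, so it is unchanged when [h] is
    normalized. *)
Definition supp_ind (h : sign_cube K -> R) : sign_cube K -> R := fun x => (h x != 0)%:R.

Lemma dep_supp_ind s h : depends_on s h -> depends_on s (supp_ind h).
Proof. exact: (dep_comp (fun r => (r != 0)%:R)). Qed.

Lemma dep_cat2 s t (h g : sign_cube K -> R) (op : R -> R -> R) :
  depends_on s h -> depends_on t g ->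
  depends_on (s ++ t) (fun x => op (h x) (g x)).
Proof.
move=> hs gt; apply: dep_comp2.
  by apply: dep_sub hs => k ks; rewrite mem_cat ks.
by apply: dep_sub gt => k kt; rewrite mem_cat kt orbT.
Qed.

Let double (h : sign_cube K -> R) k b : sign_cube K -> R :=
  fun x => 2 * (h x * at_ k b x).

Let dep_double s h k b : depends_on s h -> depends_on (k :: s) (double h k b).
Proof.
move=> hs; apply: (dep_comp ( *%R 2)); apply: dep_comp2.
  by apply: dep_sub hs => j js; rewrite inE js orbT.
by apply: dep_at; rewrite mem_head.
Qed.

Let norm_double s h k b : depends_on s h -> k \notin s ->
  `|L1_of P (double h k b)| = `|L1_of P h|.
Proof.
move=> hs ks; rewrite (L1_norm_of (dep_Lfun P (@dep_double s h k b hs))).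
rewrite (L1_norm_of (dep_Lfun P hs)).
have nhs : depends_on s (fun x => `|h x|) by exact: (dep_comp (@Num.norm _ R)).
have -> : \int[P]_x `|double h k b x| = \int[P]_x (2 * (`|h x| * at_ k b x)).
  apply: eq_Rintegral => x _; rewrite /double !normrM (ger0_norm (ler0n _ _)).
  by rewrite (ger0_norm (ler0n _ _)).
rewrite RintegralZl//.
  by rewrite (integral_at P_unif _ nhs ks) mulrA divff ?mul1r ?pnatr_eq0.
apply: (@dep_integrable _ _ _ (s ++ [:: k])); apply: dep_cat2 => //.
by apply: dep_at; rewrite mem_head.
Qed.

Let half_double s h k : depends_on s h ->
  L1_of P (double h k true) + L1_of P (double h k false) = 2 *: L1_of P h.
Proof.
move=> hs.
rewrite -L1_ofD; [|apply: dep_Lfun; exact: dep_double hs..].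
rewrite -L1_ofZ; last exact: dep_Lfun hs.
congr L1_of; apply/funext => x; rewrite !fctE /double /at_ -[_ *: _]/(2 * h x).
by case: ((x : K -> bool) k) => /=; ring.
Qed.

Let supp_double (h : sign_cube K -> R) k b x :
  supp_ind (double h k b) x = supp_ind h x * at_ k b x.
Proof.
rewrite /supp_ind /double /at_ mulf_eq0 pnatr_eq0 /= mulf_eq0 pnatr_eq0 eqb0.
rewrite negb_or negbK.
by rewrite -natrM mulnb.
Qed.

(* Concentrating [h] on half of the cube along a coordinate on which neither [h]
   nor any [G y] depends keeps its norm, halves its overlap with each [G y], and,
   the two halves averaging to [h], one of them does not decrease [g]. *)
Lemma concentrate (T : Type) (Y : set T) (S : T -> seq K) (G : T -> sign_cube K -> R)
    (g : {linear L1 P -> R^o}) (s : seq K) (h : sign_cube K -> R) (n : nat) :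
  ~ ([set: K] #<= Y)%card -> (forall y, depends_on (S y) (G y)) -> depends_on s h ->
  exists s' h', [/\ depends_on s' h', `|L1_of P h'| = `|L1_of P h|,
    g (L1_of P h) <= g (L1_of P h') &
    forall y, Y y ->
      \int[P]_x (`|G y x| * supp_ind h' x) <= 2^-1 ^+ n * \int[P]_x `|G y x|].
Proof.
move=> KY GS hs; elim: n => [|n [s' [h' [hs' nh' gh' Gh']]]].
  exists s, h; split=> // y _.
  have nG : depends_on (S y) (fun x => `|G y x|) by exact: (dep_comp (@Num.norm _ R)).
  rewrite expr0 mul1r; apply: le_Rintegral => //.
  - by apply: dep_integrable; apply: dep_cat2 nG (dep_supp_ind hs).
  - exact: dep_integrable nG.
  - by move=> x _; rewrite ler_piMr// /supp_ind lern1 leq_b1.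
have [k [ks' kS]] := fresh_coordinate S s' Kinf KY.
have [b gb] : exists b, g (L1_of P h') <= g (L1_of P (double h' k b)).
  have : g (L1_of P (double h' k true)) + g (L1_of P (double h' k false)) =
      2 * g (L1_of P h').
    by rewrite -linearD (half_double k hs') linearZ.
  have [?|lt] := leP (g (L1_of P h')) (g (L1_of P (double h' k true))).
    by exists true.
  by move=> E; exists false; lra.
exists (k :: s'), (double h' k b); split.
- exact: dep_double.
- by rewrite (norm_double b hs' ks').
- exact: le_trans gh' gb.
move=> y Yy.
have nG : depends_on (S y) (fun x => `|G y x|) by exact: (dep_comp (@Num.norm _ R)).
under eq_Rintegral do rewrite supp_double mulrA.
rewrite (@integral_at _ _ _ P_unif (S y ++ s')); last 2 first.
  exact: dep_cat2 nG (dep_supp_ind hs').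
  by rewrite mem_cat negb_or ks' kS.
by rewrite exprS -mulrA ler_pM2l ?invr_gt0// Gh'.
Qed.

(** Integrates a pointwise bound: off the support of [w] the norms add trivially, and on it
    [|G + w| >= |w| - |G|]. *)
Lemma norm_add_overlap s t (G w : sign_cube K -> R) : depends_on s G -> depends_on t w ->
  `|L1_of P G| + `|L1_of P w| - 2 * \int[P]_x (`|G x| * supp_ind w x) <=
  `|L1_of P G + L1_of P w|.
Proof.
move=> Gs wt; have GL := dep_Lfun P Gs; have wL := dep_Lfun P wt.
have nG : depends_on s (fun x => `|G x|) by exact: (dep_comp (@Num.norm _ R)).
have nw : depends_on t (fun x => `|w x|) by exact: (dep_comp (@Num.norm _ R)).
have nGw : depends_on (s ++ t) (fun x => `|G x| + `|w x|) by exact: dep_cat2.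
have ov : depends_on (s ++ t) (fun x => `|G x| * supp_ind w x).
  exact: dep_cat2 nG (dep_supp_ind wt).
have ov2 : depends_on (s ++ t) (fun x => 2 * (`|G x| * supp_ind w x)).
  exact: (dep_comp ( *%R 2) ov).
rewrite -L1_ofD// (L1_norm_of GL) (L1_norm_of wL) (L1_norm_of (rpredD GL wL)).
rewrite -RintegralD//; [|exact: dep_integrable nG|exact: dep_integrable nw].
rewrite -RintegralZl//; last exact: dep_integrable ov.
rewrite -RintegralB//; [|exact: dep_integrable nGw|exact: dep_integrable ov2].
apply: le_Rintegral => //.
- apply: (@dep_integrable _ _ _ (s ++ t)).
  exact: (dep_comp2 (fun a b => a - b) nGw ov2).
- by apply/Lfun1_integrable/Lfun_norm; rewrite rpredD.
move=> x _; rewrite /= !fctE /supp_ind; have [->|w0] := eqVneq (w x) 0.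
  by rewrite normr0 !addr0 !mulr0 subr0.
have := ler_normB (G x + w x) (G x); rewrite addrAC subrr add0r.
by rewrite mulr1; lra.
Unshelve. all: by [].
Qed.

End cube_lower.

(* The slack in the norm estimates, with [d] = eps/8 and [q] = 2^-n. *)
Lemma slack_estimate (R : realFieldType) (eps q A B C G O : R) : 0 < eps -> 0 <= q ->
  q < (eps / 8) / (1 + eps / 8) -> A <= 1 -> A - G < eps / 8 -> G - A < eps / 8 ->
  O <= q * G -> G + 1 - 2 * O <= B -> B - C < eps / 8 ->
  2 - eps < C + (1 - A).
Proof.
move=> e0 q0 qe A1 AG GA OG GB BC.
have : q * (1 + eps / 8) < eps / 8 by rewrite -ltr_pdivlMr// addr_gt0// divr_gt0.
have : q * G <= q * (1 + eps / 8) by rewrite ler_wpM2l//; lra.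
lra.
Qed.

Section lower.
Context {R : realType} {Lambda : choiceType}.
Variables (kappa : Lambda -> choiceType)
  (P : forall l, probability (sign_cube (kappa l)) R).
Hypothesis P_unif : forall l, product_of_uniform (P l).
Hypothesis kappa_inf : forall l, infinite_set [set: kappa l].
Let X := l1_sum (fun l => L1 (P l)).

Lemma Daugavet_sum (K : Type) : (exists x : X, x != 0) ->
  (forall l, ~ ([set: kappa l] #<= [set: K])%card) -> Daugavet_property X K.
Proof.
move=> [z z0] kK Y f alpha eps YS YK fc alpha0 eps0.
have [M M0 fM] := continuous_linear_le fc.
set t := sup (f @` @unit_ball R X) - alpha.
have [x0 tx0] : exists x0, t * `|x0| < f x0.
  (* For negative [t], one of [z] and [- z] already works. For [t >= 0], a near-maximizer [x] in the
     ball has [t * |x| <= t < f x]. *)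
  have [t0|t0] := leP 0 t; last first.
    have nz : t * `|z| < 0 by rewrite nmulr_rlt0// normr_gt0.
    have [fz|fz] := leP 0 (f z); first by exists z; exact: lt_le_trans fz.
    exists (- z); rewrite linearN normrN; lra.
  have fhas : has_sup (f @` @unit_ball R X).
    split; first by exists (f 0), 0 => //; rewrite /unit_ball /= normr0.
    exists M => _ [x xB <-]; rewrite (le_trans (ler_norm _))// (le_trans (fM _))//.
    by rewrite ler_piMr// ltW.
  have [_ [x xB <-] tx] := sup_adherent alpha0 fhas.
  by exists x; apply: le_lt_trans tx; rewrite ler_piMr.
have [l [u tu]] := lt_linear_coordinate fM tx0.
have glin : linear (fun v : L1 (P l) => f (l1_in v) : R^o).
  by move=> c v v'; rewrite -linearP; congr (f _); exact: l1_in_linear.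
pose g : {linear L1 (P l) -> R^o} :=
  HB.pack (fun v : L1 (P l) => f (l1_in v) : R^o)
    (GRing.isLinear.Build R (L1 (P l)) R^o _ _ glin).
have gM v : `|g v| <= M * `|v| by rewrite /= (le_trans (fM _))// l1_norm_in.
have [e e0 ge] := lt_linear_open gM tu.
have [s [h [hs /ge tgh]]] := dep_dense u e0.
pose d := eps / 8.
have d0 : 0 < d by rewrite divr_gt0.
have /choice[SG SGP] : forall y : X,
    exists p : seq (kappa l) * (sign_cube (kappa l) -> R),
    depends_on p.1 p.2 /\ `|y l - L1_of (P l) p.2| < d.
  by move=> y; have [s' [h' [? ?]]] := dep_dense (y l) d0; exists (s', h').
have kY : ~ ([set: kappa l] #<= Y)%card.
  by move=> kY; apply: (kK l); exact: card_le_trans YK.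
(* Each approximant of a coordinate has norm below [1 + d], so after [n] halvings its overlap is
   below [d]. *)
have [n nP] : exists n, 2^-1 ^+ n < d / (1 + d) :> R.
  by apply: small_power_half; rewrite divr_gt0// addr_gt0.
have [s' [h' [hs' nh' gh' ovh']]] := @concentrate _ _ _ (@P_unif l) (@kappa_inf l) _ Y
  (fun y => (SG y).1) (fun y => (SG y).2) g s h n kY (fun y => (SGP y).1) hs.
set v := L1_of (P l) h' in gh' nh'.
have tgv : t * `|v| < g v by rewrite nh'; exact: lt_le_trans tgh gh'.
(* The strict homogeneous inequality fails at 0, which makes the normalization of [v] legitimate. *)
have v0 : v != 0 by apply: contraTneq tgv => ->; rewrite normr0 mulr0 linear0 ltxx.
have nv0 : 0 < `|v| by rewrite normr_gt0.
pose w := fun x => `|v|^-1 * h' x.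
have wv : L1_of (P l) w = `|v|^-1 *: v by rewrite -L1_ofZ //; exact: dep_Lfun hs'.
have ws : depends_on s' w by exact: (dep_comp ( *%R `|v|^-1) hs').
have w1 : `|L1_of (P l) w| = 1.
  by rewrite wv normrZ normfV normr_id mulVf// gt_eqF.
exists (l1_in (L1_of (P l) w)).
  split; first by rewrite /unit_ball /= l1_norm_in w1.
  rewrite -/t -[f _]/(g (L1_of (P l) w)) wv linearZ /=.
  by rewrite -[ltRHS]/(`|v|^-1 * g v) -ltr_pdivrMl ?invr_gt0// invrK mulrC.
move=> y Yy; rewrite l1_normD_in.
have [dG yG] := SGP y.
have ovw := norm_add_overlap (P l) dG ws; rewrite w1 in ovw.
have sw : supp_ind w = supp_ind h'.
  by apply/funext => x; rewrite /supp_ind /w mulf_eq0 invr_eq0 gt_eqF.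
rewrite sw in ovw.
have ovy := ovh' y Yy; rewrite -(L1_norm_of (dep_Lfun (P l) dG)) in ovy.
have yl : `|y - l1_in (y l)| = 1 - `|y l|.
  by rewrite -(YS y Yy) (l1_normr_split l y) addrAC subrr add0r.
(* Here A and G are the norms of [y l] and of its approximant, O is the overlap, and B and C are the
   norms of the approximant and of [y l] after adding [w]. *)
rewrite yl; apply: (slack_estimate eps0 _ nP _ _ _ ovy ovw).
- by rewrite exprn_ge0 // invr_ge0.
- by rewrite -subr_ge0 -yl.
- exact: le_lt_trans (lerB_dist _ _) yG.
- by rewrite distrC in yG; exact: le_lt_trans (lerB_dist _ _) yG.
- rewrite distrC in yG; apply: le_lt_trans (lerB_dist _ _) _.
  by rewrite opprD addrACA subrr addr0.
Qed.

End lower.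

(** * Both bounds carried over to L_1(mu) *)

Theorem corollary7p2 (R : realType) (d : measure_display)
    (Omega : measurableType d) (mu : {measure set Omega -> \bar R})
    (Lambda : choiceType) (kappa : Lambda -> Type)
    (P : forall l : Lambda, probability (sign_cube (kappa l)) R) :
  atomless mu ->
  (exists f : L1 mu, f != 0) ->
  (forall l : Lambda, infinite_set [set: kappa l]) ->
  (forall l : Lambda, product_of_uniform (P l)) ->
  isometrically_isomorphic (L1 mu) (l1_sum (fun l : Lambda => L1 (P l))) ->
  exists K : Type, is_min_cardinal kappa K /\ is_Dau (L1 mu) K.
Proof.
move=> _ [f0 f0_neq0] kinf Pu iso.
(* Classical choice structure on the same carrier, giving decidable membership in lists of
   coordinates. *)
pose kap l : choiceType := {classic kappa l}.
pose X := l1_sum (fun l : Lambda => L1 (P l)).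
have Xn0 : exists x : X, x != 0.
  have [T [_ Tn]] := iso.
  by exists (T f0); rewrite -normr_eq0 Tn normr_eq0.
(* Over an empty index set the sum would be the zero space. *)
have [l0] : exists l0 : Lambda, True.
  apply: contrapT => noL; have [x /eqP] := Xn0; apply; apply: l1_sumP => l.
  by case: noL; exists l.
move=> _; have [l lmin] := min_embeds kappa l0.
exists (kappa l); split.
  by split; [exists l; exact: card_eqxx|move=> j; exact/embedsP].
split.
  move=> /(Daugavet_property_isom iso).
  exact: (@not_Daugavet_sum R Lambda kap P l (kinf l)).
(* If the least [kappa l] does not embed into [K'], no [kappa j] does, and the lower bound applies
   to [K']. *)
move=> K' nD; apply: contrapT => nle; apply: nD.
apply: Daugavet_property_isom (isometrically_isomorphic_sym iso) _.
apply: (@Daugavet_sum R Lambda kap P Pu kinf K' Xn0) => j kj; apply: nle.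
apply: card_le_trans kj; apply/embedsP; exact: (lmin j).
Qed.
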